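(* The first (smallest) eigenvalue $\lambda_{1,L}(\mathcal{A})$, which is simple, of the Laplace operator $\boldsymbol{L}$ on the three-dimensional annulus $\Omega_{\mathcal{A}}$ with vanishing Dirichlet traces satisfies $$\lim_{\mathcal{A}\to\infty}\lambda_{1,L}(\mathcal{A})=\pi^2 .$$
   Context: For $\mathcal{A}\in(0,\infty)$ let $\Omega_{\mathcal{A}}:=\{\underline{x}\in\mathbb{R}^3:\ \mathcal{A}/2<\|\underline{x}\|<1+\mathcal{A}/2\}$, where $\|\cdot\|$ is the Euclidean norm. The Laplace operator $\boldsymbol{L}$ on $\Omega=\Omega_{\mathcal{A}}$ is the Friedrichs extension in $L_2(\Omega)$ of $v\mapsto -\Delta v$ defined on $C_0^\infty(\Omega)$; its domain is $\mathring{W}_2^1(\Omega)\cap W_2^2(\Omega)$, where $W_2^k(\Omega)$ is the usual Sobolev space of order $k$ based on $L_2$ and $\mathring{W}_2^1(\Omega)$ is the closure of $C_0^\infty(\Omega)$ in $W_2^1(\Omega)$. This is the negative Dirichlet Laplacian, a positive self-adjoint operator with compact inverse and hence with pure point spectrum; $\lambda_{1,L}(\mathcal{A})$ denotes its smallest eigenvalue. *)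

(* Defs.v *)
From HB Require Import structures.
From mathcomp Require Import all_boot all_order all_algebra.
From mathcomp Require Import all_classical all_reals all_analysis.

Set Implicit Arguments.
Unset Strict Implicit.
Unset Printing Implicit Defensive.
Import Order.TTheory GRing.Theory Num.Theory.
Import numFieldNormedType.Exports.
Local Open Scope classical_set_scope.
Local Open Scope ring_scope.

(* Three-dimensional space is R * R * R, with the product of the Lebesgue
   measures. Its library norm is the sup norm; topology, continuity and
   directional derivatives do not depend on this, but the annulus does, so
   the Euclidean norm is introduced separately. *)

Section euclidean_space.
Context {R : realType}.
Implicit Types (x : R * R * R) (f g u : R * R * R -> R).

Definition enorm x : R := Num.sqrt (x.1.1 ^+ 2 + x.1.2 ^+ 2 + x.2 ^+ 2).

Definition annulus (A : R) : set (R * R * R) :=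
  [set x | A / 2 < enorm x < 1 + A / 2].

Definition volume : {measure set (measurableTypeR R * measurableTypeR R *
    measurableTypeR R) -> \bar R} :=
  ((@lebesgue_measure R \x @lebesgue_measure R) \x @lebesgue_measure R)%E.

Definition unit_vector (i : 'I_3) : R * R * R :=
  ((val i == 0%N)%:R, (val i == 1%N)%:R, (val i == 2%N)%:R).

(* A list of directions plays the role of a multi-index. *)
Definition partial (s : seq 'I_3) f : R * R * R -> R :=
  foldr (fun i g x => 'D_(unit_vector i) g x) f s.

Definition laplacian f x : R := \sum_(i < 3) partial [:: i; i] f x.

Definition smooth f : Prop :=
  forall s, continuous (partial s f) /\
    forall i x, derivable (partial s f) x (unit_vector i).

End euclidean_space.

(* Square-integrable functions on O are represented by real functions on the
   whole space, of which only the values on O matter; they are identified when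
   they agree almost everywhere on O. Here f \_ O is f extended by 0 off O. *)

Section function_spaces.
Context {R : realType}.
Variable O : set (R * R * R).
Implicit Types (f g u v : R * R * R -> R).

Definition test_function : set (R * R * R -> R) :=
  [set f | smooth f /\
    exists K, [/\ compact K, K `<=` O & forall x, ~ K x -> f x = 0]].

Definition L2 : set (R * R * R -> R) :=
  [set f | f \_ O \in Lfun volume 2%:E].

Definition L2_inner f g : R := \int[volume]_(x in O) (f x * g x).

Definition L2_cvg (v : (R * R * R -> R)^nat) u : Prop :=
  'N[volume]_2%:E[EFin \o ((v n \- u)%R \_ O)]%E @[n --> \oo] --> 0%E.

Definition ae_on f g : Prop := {ae volume, forall x, O x -> f x = g x}.

Definition weak_partial (s : seq 'I_3) u g : Prop :=
  forall w, test_function w ->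
    L2_inner u (partial s w) = (-1) ^+ size s * L2_inner g w.

Definition sobolev (k : nat) : set (R * R * R -> R) :=
  [set u | L2 u /\
    forall s, (size s <= k)%N -> exists2 g, L2 g & weak_partial s u g].

(* The closure of the test functions in the Sobolev space of order k. *)
Definition sobolev0 (k : nat) : set (R * R * R -> R) :=
  [set u | sobolev k u /\
    exists2 w : (R * R * R -> R)^nat, (forall n, test_function (w n)) &
      forall s g, (size s <= k)%N -> L2 g -> weak_partial s u g ->
        L2_cvg (fun n => partial s (w n)) g].

(* The graph of the Friedrichs extension of a nonnegative symmetric operator S
   with dense domain D: the restriction of the adjoint of S to the domain of
   the closure of the form (S v, v), that is, to the limits in L2 of sequences
   in D that are Cauchy for the form. *)
Definition friedrichs (D : set (R * R * R -> R))
    (S : (R * R * R -> R) -> (R * R * R -> R)) u f : Prop :=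
  [/\ L2 u, L2 f,
      exists w : (R * R * R -> R)^nat, [/\ forall n, D (w n), L2_cvg w u &
        forall e, 0 < e -> exists N : nat, forall m n,
          (N <= m)%N -> (N <= n)%N ->
          L2_inner (S (w m \- w n)) (w m \- w n) < e] &
      forall w, D w -> L2_inner u (S w) = L2_inner f w].

End function_spaces.

Section laplace_operator.
Context {R : realType}.
Implicit Types (A : R) (u f : R * R * R -> R).

(* The graph of the operator. For the annulus, whose boundary is smooth,
   elliptic regularity makes the first two conditions automatic; they display
   the domain of the Friedrichs extension. *)
Definition laplace_op A u f : Prop :=
  [/\ sobolev0 (annulus A) 1 u, sobolev (annulus A) 2 u &
      friedrichs (annulus A) (test_function (annulus A))
        (fun w x => - laplacian w x) u f].

Definition eigenspace_op A (lam : R) : set (R * R * R -> R) :=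
  [set u | laplace_op A u (fun x => lam * u x)].

Definition eigenvalues A : set R :=
  [set lam | exists2 u, eigenspace_op A lam u &
                        ~ ae_on (annulus A) u (cst 0)].

Definition simple_eigenvalue A (lam : R) : Prop :=
  exists u, [/\ eigenspace_op A lam u, ~ ae_on (annulus A) u (cst 0) &
    forall v, eigenspace_op A lam v ->
      exists c : R, ae_on (annulus A) v (fun x => c * u x)].

Definition lambda1 A : R := inf (eigenvalues A).

End laplace_operator.

(* Main.v *)
Require Import Defs.
From HB Require Import structures.
From mathcomp Require Import all_boot all_order all_algebra.
From mathcomp Require Import all_classical all_reals all_analysis.
From mathcomp Require Import measurable_realfun.
From mathcomp Require Import ring lra.
Set Implicit Arguments.
Unset Strict Implicit.
Unset Printing Implicit Defensive.
Import Order.TTheory GRing.Theory Num.Theory.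
Import numFieldNormedType.Exports.
Local Open Scope classical_set_scope.
Local Open Scope ring_scope.

(** The first eigenvalue is [pi ^+ 2] for every [A], not only in the limit. In
    dimension three the Laplacian of a radial function [f] is [(r f)'' / r]; since
    the annulus has thickness 1, the function
    [ground x = sin (pi (|x| - A / 2)) / |x|] is positive in the annulus, vanishes
    on its boundary and satisfies [- laplacian ground = pi ^+ 2 ground].

    It is an eigenvector of the operator ([ground_eigenvector]): it is smooth away
    from the origin, so its classical derivatives are its weak ones, and composing
    it with smooth truncations near zero gives test functions that converge to it
    together with their first derivatives.

    No eigenvalue is smaller. With [V = grad ground / ground], any test function
    [w] satisfies Jacobi's identity ([jacobi_identity])

      [energy w - pi ^+ 2 |w| ^ 2 = sum_i |d_i w - V_i w| ^ 2 >= 0],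

    an integration by parts based on Riccati's equation
    [div V + |V| ^ 2 = - pi ^+ 2]. An eigenvector [v] of eigenvalue [lam] is the
    limit of test functions [w n] that form a Cauchy sequence for the energy, and
    the energies tend to [lam |v| ^ 2] ([energy_cvg]); hence [pi ^+ 2 <= lam].

    The eigenvalue is simple: when [lam = pi ^+ 2], the right-hand side of Jacobi's
    identity tends to zero along [w n], and the quotient [v / ground] has zero weak
    gradient ([quotient_gradient_free]). Such a function is almost everywhere
    constant on each box ([gradient_free_ae_cst]): tested against tensor products
    of one-dimensional functions, the claim reduces to the fact that a test function
    on an interval is, up to the derivative of another one, a multiple of a fixed
    one. The annulus is connected, so the constant is the same on all boxes. *)

(** * Derivatives along directions and classes of smooth functions *)

(** Both the chain rule and the use of Fubini's theorem on sections go through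
    the restriction of a function to a line. *)
Lemma is_derive_lineP {R : realType} {V : normedModType R}
    (f : V -> R) (x v : V) (df : R) :
  is_derive x v f df <-> is_derive (0 : R) 1 (fun h : R => f (h *: v + x)) df.
Proof.
have line : 'D_v f x = 'D_1 (fun h : R => f (h *: v + x)) 0.
  rewrite /derive; congr (lim _).
  apply: (congr1 (fun F : R -> R => F @ 0^')); apply/funext => h /=.
  by rewrite addr0 scale0r add0r [h%:A]mulr1.
split=> -[fd fE]; apply: DeriveDef.
- exact: (derivable1P f x v).1 fd.
- by rewrite -line.
- exact: (derivable1P f x v).2 fd.
- by rewrite line.
Qed.

Lemma is_derive_scalar_comp {R : realType} {V : normedModType R}
    (f : V -> R) (phi : R -> R) (x v : V) (df dphi : R) :
  is_derive (f x) 1 phi dphi -> is_derive x v f df ->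
  is_derive x v (phi \o f) (dphi * df).
Proof.
move=> hphi /is_derive_lineP hf; apply/is_derive_lineP.
have hphi' : is_derive (f (0 *: v + x)) 1 phi dphi by rewrite scale0r add0r.
exact: (is_derive1_comp hphi' hf).
Qed.

Lemma is_derive_inv {R : realType} (t : R) : t != 0 ->
  is_derive t 1 (@GRing.inv R) (- (t^-1 * t^-1)).
Proof.
move=> t0; have di : derivable (id : R -> R) t 1 by exact: derivable_id.
apply: DeriveDef; first exact: (@derivableV R R id t 1 t0 di).
rewrite (@deriveV R R id t 1 t0 di) derive_id.
by rewrite /GRing.scale /= mulr1 expr2 invfM.
Qed.

Section classes.
Context {R : realType} {V : normedModType R} {I : Type} (e : I -> V).
Implicit Types (n : nat) (O : set V) (f g : V -> R).

(** Differentiability of order [n] is asked along the directions [e] only, and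
    each derivative is a witness of the next lower order: closure under products
    and compositions is then an induction on [n] without Leibniz's formula. *)
Fixpoint Ck n O f : Prop :=
  (forall x, O x -> {for x, continuous f}) /\
  if n is n'.+1 then
    forall i, exists2 g, Ck n' O g & forall x, O x -> is_derive x (e i) f (g x)
  else True.

Lemma Ck_continuous n O f x : Ck n O f -> O x -> {for x, continuous f}.
Proof. by case: n => [|n] [cf _]; exact: cf. Qed.

Lemma CkS n O f : Ck n.+1 O f -> Ck n O f.
Proof.
elim: n f => [|n IH] f [cf h]; split=> // i.
by have [g /IH hg dg] := h i; exists g.
Qed.

Lemma Ck_le m n O f : (m <= n)%N -> Ck n O f -> Ck m O f.
Proof.
by move=> /subnK <-; elim: (n - m)%N => [|k IH]//; rewrite addSn => /CkS.
Qed.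

Lemma Ck_sub n O O' f : O `<=` O' -> Ck n O' f -> Ck n O f.
Proof.
move=> OO'; elim: n f => [|n IH] f /= [cf h]; split => //.
- by move=> x /OO'; exact: cf.
- by move=> x /OO'; exact: cf.
by move=> i; have [g /IH hg dg] := h i; exists g => // x /OO'; exact: dg.
Qed.

(** Derivatives only depend on germs, so on an open set the class only depends
    on the values there. *)
Lemma Ck_eq n O f g : open O -> (forall x, O x -> f x = g x) ->
  Ck n O f -> Ck n O g.
Proof.
move=> oO fg.
have nfg x : O x -> \forall y \near x, f y = g y.
  by move=> Ox; near=> y; apply: fg; near: y; exact: open_nbhs_nbhs.
have cg h : (forall x, O x -> {for x, continuous h}) ->
    (forall x, O x -> \forall y \near x, h y = g y) ->
    forall x, O x -> {for x, continuous g}.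
  move=> ch hg x Ox; rewrite /prop_for /continuous_at.
  rewrite -(nbhs_singleton (hg x Ox)); apply: cvg_trans (ch x Ox).
  exact/near_eq_cvg/hg.
case: n => [|n] /= [cf h]; split => //; try exact: cg nfg.
move=> i; have [k hk dk] := h i; exists k => // x Ox.
exact: near_eq_is_derive (nfg x Ox) (dk x Ox).
Unshelve. all: by end_near. Qed.

Lemma Ck_cst n O (c : R) : Ck n O (cst c).
Proof.
elim: n c => [|n IH] c /=; split=> //; try by move=> *; exact: cst_continuous.
by move=> i; exists (cst 0) => // x _; exact: is_derive_cst.
Qed.

Lemma CkD n O f g : Ck n O f -> Ck n O g -> Ck n O (f \+ g).
Proof.
elim: n f g => [|n IH] f g /= [cf hf] [cg hg]; split=> //.
- by move=> x Ox; apply: continuousD; [exact: cf|exact: cg].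
- by move=> x Ox; apply: continuousD; [exact: cf|exact: cg].
move=> i; have [f' hf' df'] := hf i; have [g' hg' dg'] := hg i.
exists (f' \+ g'); first exact: IH.
by move=> x Ox; apply: is_deriveD; [exact: df'|exact: dg'].
Qed.

Lemma CkM n O f g : Ck n O f -> Ck n O g -> Ck n O (f \* g).
Proof.
elim: n f g => [|n IH] f g Cf Cg; (split; first by
  move=> x Ox; apply: continuousM; [exact: Ck_continuous Cf Ox|
    exact: Ck_continuous Cg Ox]) => //.
move=> i; have [f' hf' df'] := Cf.2 i; have [g' hg' dg'] := Cg.2 i.
exists ((f \* g') \+ (g \* f')).
  by apply: CkD; apply: IH => //; apply: CkS.
by move=> x Ox; apply: is_deriveM; [exact: df'|exact: dg'].
Qed.

Lemma CkZ n O (c : R) f : Ck n O f -> Ck n O (fun x => c * f x).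
Proof. by move=> Cf; apply: (CkM (Ck_cst n O c) Cf). Qed.

Lemma CkN n O f : Ck n O f -> Ck n O (fun x => - f x).
Proof.
move=> Cf; have -> : (fun x => - f x) = (fun x => -1 * f x).
  by apply/funext => x; rewrite mulN1r.
exact: CkZ.
Qed.

Lemma CkB n O f g : Ck n O f -> Ck n O g -> Ck n O (fun x => f x - g x).
Proof. by move=> Cf Cg; apply: (CkD Cf (CkN Cg)). Qed.

Lemma Ck_sum n O (J : Type) (r : seq J) (F : J -> V -> R) :
  (forall j, Ck n O (F j)) -> Ck n O (fun x => \sum_(j <- r) F j x).
Proof.
move=> CF; elim: r => [|j r IH].
  under eq_fun do rewrite big_nil; exact: Ck_cst.
under eq_fun do rewrite big_cons; exact: (CkD (CF j) IH).
Qed.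

End classes.

Definition Ck1 {R : realType} := @Ck R R unit (fun=> 1).

Section composition.
Context {R : realType} {V : normedModType R} {I : Type} (e : I -> V).

Lemma Ck_comp n (O : set V) (D : set R) (phi : R -> R) (f : V -> R) :
  Ck1 n D phi -> Ck e n O f -> (forall x, O x -> D (f x)) ->
  Ck e n O (phi \o f).
Proof.
elim: n phi => [|n IH] phi Cphi Cf fD; (split; first by
  move=> x Ox; apply: continuous_comp; [exact: Ck_continuous Cf Ox|
    exact: Ck_continuous Cphi (fD _ Ox)]) => //.
move=> i; have [phi' hphi' dphi'] := Cphi.2 tt; have [f' hf' df'] := Cf.2 i.
exists ((phi' \o f) \* f').
  by apply: CkM => //; apply: IH => //; exact: CkS.
by move=> x Ox; apply: is_derive_scalar_comp; [exact: (dphi' _ (fD _ Ox))|exact: df'].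
Qed.

(** A family of functions is smooth as soon as its derivatives are built from the
    family itself. *)
Lemma Ck1_family (J : Type) (D : set R) (F : J -> R -> R)
    (F' : J -> R -> R) :
  (forall j x, D x -> is_derive x 1 (F j) (F' j x)) ->
  (forall n, (forall j, Ck1 n D (F j)) -> forall j, Ck1 n D (F' j)) ->
  forall n j, Ck1 n D (F j).
Proof.
move=> dF step.
have cF j x : D x -> {for x, continuous (F j)}.
  move=> Dx; apply: differentiable_continuous; apply/derivable1_diffP.
  by have [] := dF j x Dx.
elim=> [|n IH] j; (split; first by move=> x; exact: cF) => //.
by move=> _; exists (F' j); [exact: step|exact: dF].
Qed.

Lemma Ck1_inv n : Ck1 n [set t : R | t != 0] (@GRing.inv R).
Proof.
have d (j : unit) (x : R) : [set t : R | t != 0] x ->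
    is_derive x 1 (@GRing.inv R) (- (x^-1 * x^-1)) by exact: is_derive_inv.
apply: (Ck1_family d _ n tt) => m Cm _; exact: CkN (CkM (Cm tt) (Cm tt)).
Qed.

Lemma Ck_inv n (O : set V) (f : V -> R) : Ck e n O f ->
  (forall x, O x -> f x != 0) -> Ck e n O (fun x => (f x)^-1).
Proof. by move=> Cf f0; exact: Ck_comp (Ck1_inv n) Cf f0. Qed.

End composition.

Section elementary_functions.
Context {R : realType}.

Lemma Ck1_id n (D : set R) : Ck1 n D id.
Proof.
elim: n => [|n IH]; (split; first by move=> x Dx; exact: cvg_id) => // i.
by exists (cst 1); [exact: Ck_cst|move=> y Dy; exact: is_derive_id].
Qed.

Lemma Ck1_sqrt n : Ck1 n [set t : R | 0 < t] Num.sqrt.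
Proof.
have d (j : unit) (x : R) : [set t : R | 0 < t] x ->
    is_derive x 1 (@Num.sqrt R : R -> R) (2 * Num.sqrt x)^-1.
  by move=> x0; exact: is_derive1_sqrt.
apply: (Ck1_family d _ n tt) => m Cm _.
apply: Ck_inv; first exact: CkZ (Cm tt).
by move=> x x0; rewrite mulf_neq0 // gt_eqF // sqrtr_gt0.
Qed.

Lemma Ck1_sincos n (b : bool) (D : set R) : Ck1 n D (if b then @sin R else cos).
Proof.
have d (c : bool) (x : R) : D x -> is_derive x 1 (if c then @sin R else cos)
    ((if c then @cos R else (fun x => - sin x)) x).
  by case: c => _; [exact: is_derive_sin|exact: is_derive_cos].
apply: (Ck1_family d _ n b) => m Cm [] /=; first exact: (Cm false).
exact: CkN (Cm true).
Qed.

End elementary_functions.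

(** * A flat function, gluing, and the Euclidean norm *)

Section flat.
Context {R : realType}.

(** The exponential factor is the standard smooth function vanishing on a
    half-line; the powers of [t^-1] make the family stable under derivation. *)
Definition flat (k : nat) (t : R) : R :=
  if 0 < t then t^-1 ^+ k * expR (- t^-1) else 0.

Lemma flat_le0 k t : t <= 0 -> flat k t = 0.
Proof. by rewrite /flat; case: ltP. Qed.

Lemma flat_ge0 k t : 0 <= flat k t.
Proof.
rewrite /flat; case: ifP => // t0.
by rewrite mulr_ge0 ?expR_ge0 // exprn_ge0 // invr_ge0 ltW.
Qed.

Lemma flat_mul k t : flat k t = flat k.+1 t * t.
Proof.
rewrite /flat; case: ifP => [t0|_]; last by rewrite mul0r.
by rewrite exprS mulrAC (mulrAC t^-1) mulVf ?gt_eqF // mul1r.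
Qed.

(** With [y = t^-1] this is [y ^+ k.+1 * expR (- y)] bounded, which follows from
    [expR z >= z] at [z = y / k.+1]. *)
Lemma flat_bound k t : flat k t <= k.+1%:R ^+ k.+1 * `|t|.
Proof.
rewrite /flat; case: ifP => [t0|_]; last first.
  by rewrite mulr_ge0 // exprn_ge0.
set y := t^-1; have y0 : 0 < y by rewrite invr_gt0.
rewrite gtr0_norm // -[t]invrK -/y ler_pdivlMr // mulrAC -exprSr expRN.
rewrite ler_pdivrMr ?expR_gt0 //.
have -> : y = k.+1%:R * (y / k.+1%:R) by rewrite mulrC divfK // pnatr_eq0.
rewrite expRM_natl exprMn ler_pM2l ?exprn_gt0 ?ltr0n //.
apply: lerXn2r; rewrite ?nnegrE ?expR_ge0 ?divr_ge0 ?ler0n ?ltW //.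
by apply: lt_le_trans (expR_ge1Dx _); rewrite ltrDr.
Qed.

Lemma flat_continuous0 k : {for (0 : R), continuous (flat k)}.
Proof.
rewrite /prop_for /continuous_at flat_le0 //.
apply: (@squeeze_cvgr _ _ _ _ (cst 0) (fun t => k.+1%:R ^+ k.+1 * `|t|)).
- by near=> t; rewrite flat_ge0 flat_bound.
- exact: cvg_cst.
- rewrite -[X in _ --> X](mulr0 (k.+1%:R ^+ k.+1)); apply: cvgMr.
  by rewrite -[X in _ --> X](@normr0 _ R); apply: cvg_norm; exact: cvg_id.
Unshelve. all: by end_near. Qed.

(** At the origin the difference quotient of [flat k] is [flat k.+1], which tends
    to zero. *)
Lemma is_derive_flat k (t : R) :
  is_derive t 1 (flat k) (flat k.+2 t - k%:R * flat k.+1 t).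
Proof.
have [t0|t0|->] := ltgtP t 0.
- rewrite !flat_le0 ?ltW // mulr0 subrr.
  apply: (@near_eq_is_derive R R R (cst 0)).
  by near=> s; rewrite flat_le0 // ltW //; near: s; exact: lt_nbhsl.
- have tn0 : t != 0 by rewrite gt_eqF.
  have dV := is_derive_inv tn0.
  have dX : is_derive t 1 (fun s : R => s^-1 ^+ k)
     (- (k%:R * t^-1 ^+ k.+1)).
    elim: k => [|k IH].
      by rewrite mul0r oppr0; under eq_fun do rewrite expr0; exact: is_derive_cst.
    under eq_fun do rewrite exprS.
    apply: (is_derive_eq (is_deriveM dV IH)).
    rewrite /GRing.scale /= -natr1 !exprS; ring.
  have dE : is_derive t 1 (fun s : R => expR (- s^-1))
     (expR (- t^-1) * (t^-1 * t^-1)).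
    have dN := is_deriveN dV; rewrite opprK in dN.
    exact: (is_derive_scalar_comp (is_derive_expR _) dN).
  have dM := is_deriveM dX dE.
  have nf : \forall s \near t, s^-1 ^+ k * expR (- s^-1) = flat k s.
    by near=> s; rewrite /flat ifT //; near: s; exact: lt_nbhsr.
  apply: (is_derive_eq (near_eq_is_derive nf dM)).
  rewrite /GRing.scale /= /flat t0 !exprS; ring.
- rewrite [X in X - _]flat_le0 // flat_le0 // mulr0 subrr.
  apply/is_derive1_caratheodory; exists (flat k.+1); split.
  + by move=> z; rewrite (flat_le0 k (lexx 0)) !subr0 flat_mul.
  + exact: flat_continuous0.
  + exact: flat_le0.
Unshelve. all: by end_near. Qed.

Lemma Ck1_flat n k (D : set R) : Ck1 n D (flat k).
Proof.
have d (j : nat) (x : R) : D x -> is_derive x 1 (flat j)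
   (flat j.+2 x - j%:R * flat j.+1 x) by move=> _; exact: is_derive_flat.
apply: (Ck1_family d _ n k) => m Cm j; exact: CkB (Cm _) (CkZ _ (Cm _)).
Qed.

Lemma flat0_le1 (t : R) : flat 0 t <= 1.
Proof.
rewrite /flat; case: ifP => // t0.
by rewrite expr0 mul1r -expR0 ler_expR oppr_le0 invr_ge0 ltW.
Qed.

End flat.

Section smooth_compact_support.
Context {R : realType} {V : normedModType R} {I : Type} (e : I -> V).

(** The complement of [K] and [O] form an open cover, and on the former [f] and
    all its derivatives vanish. *)
Lemma Ck_glue n (O K : set V) (f : V -> R) : open O -> closed K -> K `<=` O ->
  (forall x, ~ K x -> f x = 0) -> Ck e n O f -> Ck e n setT f.
Proof.
move=> oO cK KO; have oKc : open (~` K) by exact: closed_openC.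
have nK g x : (forall x, ~ K x -> g x = 0 :> R) -> ~ K x -> \forall y \near x, 0 = g y.
  move=> g0 Kx; near=> y; apply/esym/g0; near: y; exact: open_nbhs_nbhs.
have cg (g : V -> R) : (forall x, ~ K x -> g x = 0) ->
    (forall x, O x -> {for x, continuous g}) ->
    forall x, [set: V] x -> {for x, continuous g}.
  move=> g0 cO x _; have [/KO/cO//|Kx] := pselect (K x).
  rewrite /prop_for /continuous_at (g0 _ Kx).
  by apply: (cvg_trans (near_eq_cvg (nK _ _ g0 Kx))); exact: cvg_cst.
elim: n f => [|n IH] f f0 Cf; (split; first by
  by apply: cg => // x; exact: Ck_continuous Cf) => // i.
have [g Cg dg] := Cf.2 i.
pose g' x := if pselect (K x) then g x else 0.
have g'E x : O x -> g x = g' x.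
  move=> Ox; rewrite /g'; case: pselect => // Kx.
  have [_ <-] := dg x Ox.
  by have [_ <-] := near_eq_is_derive (nK _ _ f0 Kx) (is_derive_cst 0 x (e i)).
exists g'.
  apply: IH; last exact: Ck_eq Cg.
  by move=> x Kx; rewrite /g'; case: pselect.
move=> x _; have [Kx|Kx] := pselect (K x); first by rewrite -g'E; auto.
rewrite /g'; case: pselect => [//|Kx'].
exact: near_eq_is_derive (nK _ _ f0 Kx) (is_derive_cst 0 x (e i)).
Unshelve. all: by end_near. Qed.

Lemma derive_off_support (K : set V) (f : V -> R) v x : closed K ->
  (forall x, ~ K x -> f x = 0) -> ~ K x -> 'D_v f x = 0.
Proof.
move=> cK f0 Kx; rewrite (@near_eq_derive _ _ _ f (cst 0)) ?derive_cst //.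
have oK : open (~` K) by exact: closed_openC.
by near=> y; rewrite f0 //; near: y; exact: open_nbhs_nbhs.
Unshelve. all: by end_near. Qed.

End smooth_compact_support.

Section coordinates.
Context {R : realType}.
Local Notation V := (R * R * R)%type.
Local Notation ev := (@unit_vector R).

Definition coord (j : 'I_3) (x : V) : R :=
  if val j is 0%N then x.1.1 else if val j is 1%N then x.1.2 else x.2.

Lemma coord_line (j i : 'I_3) (h : R) (x : V) :
  coord j (h *: ev i + x) = h * (i == j)%:R + coord j x.
Proof.
by rewrite /coord /unit_vector -val_eqE; case: i j => [[|[|[|//]]] ?] [[|[|[|//]]] ?].
Qed.

Lemma is_derive_coord (j i : 'I_3) (x : V) :
  is_derive x (ev i) (coord j) (i == j)%:R.
Proof.
apply/is_derive_lineP; rewrite (funext (fun h => coord_line j i h x)).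
set c : R := (i == j)%:R.
have hM : is_derive (0:R) 1 (fun h : R => h * c) c.
  apply: (is_derive_eq (is_deriveM (is_derive_id (0:R) (1:R)) (is_derive_cst _ _ _))).
  by rewrite /GRing.scale /= mulr0 add0r mulr1.
by apply: (is_derive_eq (is_deriveD hM (is_derive_cst _ _ _))); rewrite addr0.
Qed.

Lemma coord_continuous j : continuous (coord j : V -> R).
Proof.
have c1 (A B : topologicalType) : continuous (@fst A B) by move=> x; exact: cvg_fst.
have c2 (A B : topologicalType) : continuous (@snd A B) by move=> x; exact: cvg_snd.
move=> x; rewrite /coord; case: j => [[|[|[|//]]] ?] /=; last exact: c2.
  by apply: (@continuous_comp _ _ _ (@fst (R * R)%type R) (@fst R R)); exact: c1.
apply: (@continuous_comp _ _ _ (@fst (R * R)%type R) (@snd R R)); first exact: c1.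
exact: c2.
Qed.

Lemma Ck_coord n O j : Ck ev n O (coord j).
Proof.
case: n => [|n]; (split; first by move=> x _; exact: coord_continuous) => // i.
by exists (cst (i == j)%:R); [exact: Ck_cst|move=> x _; exact: is_derive_coord].
Qed.

Lemma smooth_Ck (f : V -> R) : smooth f <-> forall n, Ck ev n setT f.
Proof.
split=> [sf n|Cf s].
  suff: forall s, Ck ev n setT (partial s f) by move/(_ [::]).
  elim: n => [|n IH] s; (split; first by move=> x _; exact: (sf s).1) => // i.
  exists (partial (i :: s) f) => // x _.
  by apply: DeriveDef => //; exact: (sf s).2.
have Cs n : Ck ev n setT (partial s f).
  elim: s n => [|i s IH] n; first exact: Cf.
  have [g Cg dg] := (IH n.+1).2 i.
  by rewrite (_ : partial _ _ = g) //; apply/funext => x; have [_] := dg x I.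
split=> [x|i x]; first exact: (Ck_continuous (Cs 0%N)).
by have [g _ dg] := (Cs 1%N).2 i; have [] := dg x I.
Qed.

Lemma sqr_enormE (x : V) : enorm x ^+ 2 = x.1.1 ^+ 2 + x.1.2 ^+ 2 + x.2 ^+ 2.
Proof. by rewrite sqr_sqrtr // !addr_ge0 // sqr_ge0. Qed.

Lemma sum_coord_sqr (x : V) : \sum_(i < 3) coord i x ^+ 2 = enorm x ^+ 2.
Proof. by rewrite sqr_enormE !big_ord_recr big_ord0 /= add0r. Qed.

Lemma is_derive_enorm (x : V) i : 0 < enorm x ->
  is_derive x (ev i) enorm (coord i x / enorm x).
Proof.
move=> x0; have q0 : 0 < \sum_(j < 3) coord j x ^+ 2.
  by rewrite sum_coord_sqr exprn_gt0.
have dq : is_derive x (ev i) (fun x => \sum_(j < 3) coord j x ^+ 2) (2 * coord i x).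
  have dX j : is_derive x (ev i) (fun x => coord j x ^+ 2) (2 * coord j x * (i == j)%:R).
    have dj := is_derive_coord j i x.
    under eq_fun do rewrite expr2.
    by apply: (is_derive_eq (is_deriveM dj dj)); rewrite /GRing.scale /=; ring.
  have dS := is_derive_sum dX.
  have -> : (fun x => \sum_(j < 3) coord j x ^+ 2) =
      \sum_(j < 3) (fun x => coord j x ^+ 2).
    by apply/funext => y; rewrite fct_sumE.
  apply: (is_derive_eq dS).
  rewrite (bigD1 i) //= eqxx mulr1 big1 ?addr0 //.
  by move=> j /negbTE; rewrite eq_sym => ->; rewrite mulr0.
have -> : enorm = Num.sqrt \o (fun x => \sum_(j < 3) coord j x ^+ 2).
  by apply/funext => y /=; rewrite /enorm !big_ord_recr big_ord0 /= add0r.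
apply: (is_derive_eq (is_derive_scalar_comp (is_derive1_sqrt q0) dq)).
by rewrite /= invfM mulrACA mulVf ?pnatr_eq0 // mul1r mulrC.
Qed.

Lemma Ck_enorm n : Ck ev n [set x | 0 < enorm x] enorm.
Proof.
have -> : enorm = Num.sqrt \o (fun x => \sum_(j < 3) coord j x * coord j x).
  by apply/funext => y /=; rewrite /enorm !big_ord_recr big_ord0 /= add0r.
apply: Ck_comp (Ck1_sqrt n) _ _ => [|x].
  by apply: Ck_sum => j; apply: CkM; exact: Ck_coord.
by rewrite /= sqrtr_gt0.
Qed.

Lemma enorm_continuous : continuous (@enorm R).
Proof.
move=> x; have -> : @enorm R = Num.sqrt \o (fun x => \sum_(j < 3) coord j x * coord j x).
  by apply/funext => y /=; rewrite /enorm !big_ord_recr big_ord0 /= add0r.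
apply: continuous_comp; last exact: sqrt_continuous.
suff /Ck_continuous : Ck ev 0 setT (fun x => \sum_(j < 3) coord j x * coord j x) by exact.
by apply: Ck_sum => j; apply: CkM; exact: Ck_coord.
Qed.

End coordinates.

(** * Boxes and the divergence theorem for compact supports *)

Section boxes.
Context {R : realType}.
Local Notation V := (R * R * R)%type.

Definition obox (p q : V) : set V :=
  [set x | [/\ p.1.1 < x.1.1 < q.1.1, p.1.2 < x.1.2 < q.1.2 &
               p.2 < x.2 < q.2]].

Definition cbox (p q : V) : set V :=
  [set x | [/\ p.1.1 <= x.1.1 <= q.1.1, p.1.2 <= x.1.2 <= q.1.2 &
               p.2 <= x.2 <= q.2]].

Lemma obox_cbox p q : obox p q `<=` cbox p q.
Proof.
by move=> x [/andP[a b] /andP[c d] /andP[e f]]; split; apply/andP; split; exact: ltW.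
Qed.

Lemma oboxE p q : obox p q =
  (`]p.1.1, q.1.1[%classic `*` `]p.1.2, q.1.2[%classic) `*` `]p.2, q.2[%classic.
Proof.
by apply/seteqP; split=> x /=; rewrite !in_itv /=; [case=> ? ? ?|case=> [[? ?] ?]].
Qed.

Lemma cboxE p q : cbox p q =
  (`[p.1.1, q.1.1]%classic `*` `[p.1.2, q.1.2]%classic) `*` `[p.2, q.2]%classic.
Proof.
by apply/seteqP; split=> x /=; rewrite !in_itv /=; [case=> ? ? ?|case=> [[? ?] ?]].
Qed.

Lemma open_obox p q : open (obox p q).
Proof.
have -> : obox p q = (coord (inord 0) @^-1` `]p.1.1, q.1.1[%classic) `&`
    ((coord (inord 1) @^-1` `]p.1.2, q.1.2[%classic) `&`
     (coord (inord 2) @^-1` `]p.2, q.2[%classic)).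
  apply/seteqP; split=> x /=; rewrite /coord /= !inordK //= !in_itv /=.
    by case=> ? ? ?.
  by case=> ? [? ?].
have co j := (continuousP (coord j)).1 (@coord_continuous R j).
by apply: openI; [|apply: openI]; apply: co; exact: interval_open.
Qed.

Lemma compact_cbox p q : compact (cbox p q).
Proof.
by rewrite cboxE; apply: compact_setX; [apply: compact_setX|]; exact: segment_compact.
Qed.

Local Notation M := (measurableTypeR R * measurableTypeR R * measurableTypeR R)%type.

Lemma measurable_obox p q : measurable (obox p q : set M).
Proof.
by rewrite oboxE; apply: measurableX; [apply: measurableX|]; exact: measurable_itv.
Qed.

Lemma measurable_cbox p q : measurable (cbox p q : set M).
Proof.
by rewrite cboxE; apply: measurableX; [apply: measurableX|]; exact: measurable_itv.
Qed.

Lemma volume_cbox p q : (volume (cbox p q : set M) < +oo)%E.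
Proof.
have l8 (a b : R) : (0 <= lebesgue_measure `[a, b]%classic < +oo)%E.
  rewrite measure_ge0 lebesgue_measure_itv /=.
  by case: ifP => _; rewrite ?ltry // -EFinB ltry.
have [a0 a8] := andP (l8 p.1.1 q.1.1); have [b0 b8] := andP (l8 p.1.2 q.1.2).
have [c0 c8] := andP (l8 p.2 q.2).
rewrite cboxE /volume /= !product_measure1E //; last exact: measurableX.
apply: lte_mul_pinfty => //; rewrite ge0_fin_numE //.
set A := (X in (_ X < _)%E).
suff : ((lebesgue_measure \x lebesgue_measure) A < +oo)%E by [].
by rewrite product_measure1E //; apply: lte_mul_pinfty => //; rewrite ge0_fin_numE.
Qed.

Definition rat_point (k : rat * rat * rat) : V :=
  ((ratr k.1.1, ratr k.1.2), ratr k.2).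

(** Rational boxes give countable covers of open sets. *)
Lemma rational_box (U : set V) x : open U -> U x -> exists p q,
  obox (rat_point p) (rat_point q) x /\ cbox (rat_point p) (rat_point q) `<=` U.
Proof.
move=> oU Ux; have /nbhs_ballP[d /= d0 dU] := open_nbhs_nbhs (conj oU Ux).
have lo (t : R) : exists q : rat, t - d < ratr q < t.
  have [q] := @rat_in_itvoo R (t - d) t ltac:(by rewrite gtrBl).
  by rewrite in_itv /= => h; exists q.
have hi (t : R) : exists q : rat, t < ratr q < t + d.
  have [q] := @rat_in_itvoo R t (t + d) ltac:(by rewrite ltrDl).
  by rewrite in_itv /= => h; exists q.
have [p1 /andP[? ?]] := lo x.1.1; have [p2 /andP[? ?]] := lo x.1.2.
have [p3 /andP[? ?]] := lo x.2.
have [q1 /andP[? ?]] := hi x.1.1; have [q2 /andP[? ?]] := hi x.1.2.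
have [q3 /andP[? ?]] := hi x.2.
exists ((p1, p2), p3), ((q1, q2), q3); split.
  by split => /=; apply/andP.
move=> y [/= /andP[? ?] /andP[? ?] /andP[? ?]]; apply: dU; split; first split;
  rewrite /ball /= ltr_norml; lra.
Qed.

Lemma open_measurable3 (U : set V) : open U -> measurable (U : set M).
Proof.
move=> oU.
pose B (k : rat * rat * rat * (rat * rat * rat)) : set M :=
  [set x | obox (rat_point k.1) (rat_point k.2) x /\
           cbox (rat_point k.1) (rat_point k.2) `<=` U].
have -> : U = \bigcup_k B k.
  apply/seteqP; split=> [x Ux|x [k _ [kx kU]]]; last exact/kU/obox_cbox.
  by have [p [q [h1 h2]]] := rational_box oU Ux; exists (p, q).
apply: countable_bigcupT_measurable => // k; rewrite /B.
have [kU|kU] := pselect (cbox (rat_point k.1) (rat_point k.2) `<=` U).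
  rewrite (_ : [set _ | _] = obox (rat_point k.1) (rat_point k.2)).
    exact: measurable_obox.
  by apply/seteqP; split=> x //= [].
rewrite (_ : [set _ | _] = set0) //.
by apply/seteqP; split=> x //= [].
Qed.

Lemma continuous_measurable3 (f : V -> R) : continuous f ->
  measurable_fun (setT : set M) (f : M -> R).
Proof.
move=> /continuousP cf.
apply: (measurability _ (RGenOpens.measurableE R)) => //.
move=> _ [_ [a [b ->] <-]]; rewrite setTI; apply: open_measurable3; apply: cf.
exact: interval_open.
Qed.

Lemma compact_in_box (K : set V) : compact K -> exists2 N : R, 0 < N &
  K `<=` cbox (- N, - N, - N) (N, N, N).
Proof.
move=> /compact_bounded /pinfty_ex_gt0[N N0 KN]; exists N => // x /KN /=.
rewrite !prod_normE /= !ge_max => /andP[/andP[]].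
by rewrite !ler_norml => a b c; split.
Qed.

Lemma compact_image_bounded (K : set V) (f : V -> R) : compact K ->
  {within K, continuous f} -> exists2 N : R, 0 < N & forall x, K x -> `|f x| <= N.
Proof.
move=> cK cf; have := continuous_compact cf cK.
move=> /compact_bounded /pinfty_ex_gt0[N N0 KN]; exists N => // x Kx.
by apply: KN => /=; exists x.
Qed.

Lemma bounded_integrable (D : set M) (f : M -> R) (N : R) : measurable D ->
  (volume D < +oo)%E -> measurable_fun D f -> (forall x, D x -> `|f x| <= N) ->
  (@volume R).-integrable D (EFin \o f).
Proof.
move=> mD D8 mf fN; apply: measurable_bounded_integrable => //.
exists N; split; first exact: num_real.
by move=> y Ny x Dx; apply: le_trans (fN _ Dx) (ltW Ny).
Qed.

Lemma compact_support_integrable (f : V -> R) (K : set V) : continuous f ->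
  compact K -> (forall x, ~ K x -> f x = 0) ->
  (@volume R).-integrable setT (EFin \o f).
Proof.
move=> cf cK f0; have [N N0 KN] := compact_in_box cK.
set B := cbox _ _ in KN.
have mB : measurable (B : set M) by exact: measurable_cbox.
have -> : EFin \o f = (EFin \o f) \_ B.
  apply/funext => x; rewrite /= patchE; case: ifPn => //.
  by rewrite notin_setE => Bx; rewrite /= f0 // => /KN.
rewrite -(integrable_mkcond _ mB).
have [m m0 fm] := @compact_image_bounded B f (@compact_cbox _ _)
  (continuous_subspaceT cf).
apply: (@bounded_integrable _ _ m) => //; first exact: volume_cbox.
by apply: measurable_funTS; exact: continuous_measurable3.
Qed.

End boxes.

Section plane_measure.
Context {R : realType}.
Local Notation leb := (@lebesgue_measure R).

(** An alias carrying the sigma-finiteness that Fubini's theorem asks of the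
    first factor of [volume]. *)
Definition area : set (measurableTypeR R * measurableTypeR R) -> \bar R :=
  (leb \x leb)%E.

HB.instance Definition _ := Measure.on area.

Lemma area_sigma_finite : sigma_finite setT area.
Proof.
pose I (n : nat) := `[- n%:R, n%:R]%classic : set R.
exists (fun n => I n `*` I n).
  apply/esym/seteqP; split=> // -[x y] _.
  exists (maxn (Num.truncn `|x|).+1 (Num.truncn `|y|).+1) => //.
  have h (t : R) m : ((Num.truncn `|t|).+1 <= m)%N -> I m t.
    move=> tm; rewrite /I /= in_itv /= -ler_norml.
    by apply: le_trans (ltW (truncnS_gt _)) _; rewrite ler_nat.
  by split; apply: h; [exact: leq_maxl|exact: leq_maxr].
move=> n; split; first by apply: measurableX; exact: measurable_itv.
have I8 : (leb (I n) < +oo)%E.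
  by rewrite lebesgue_measure_itv /=; case: ifP => _; rewrite ?ltry // -EFinB ltry.
rewrite /area product_measure1E //; try exact: measurable_itv.
by apply: lte_mul_pinfty => //; rewrite ge0_fin_numE.
Qed.

HB.instance Definition _ := Measure_isSigmaFinite.Build _ _ _ area
  area_sigma_finite.

End plane_measure.

Section divergence.
Context {R : realType}.
Local Notation V := (R * R * R)%type.
Local Notation ev := (@unit_vector R).
Local Notation leb := (@lebesgue_measure R).

Local Notation T1 := (measurableTypeR R).
Local Notation leb2 := (@area R).

Lemma integral_planes (f : T1 * T1 * T1 -> \bar R) :
  (@volume R).-integrable setT f ->
  (forall z, leb2.-integrable setT (fun xy => f (xy, z)) ->
     \int[leb2]_xy f (xy, z) = 0)%E ->
  (\int[volume]_x f x = 0)%E.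
Proof.
move=> ig h.
have E := @integral21_prod_meas1 _ _ _ T1 R leb2 leb f ig.
rewrite /volume -E (@ae_eq_integral _ _ _ leb setT (cst 0%E)) //.
- exact: integral0.
- exact: (@measurable_fubini_G _ _ _ T1 R leb2 leb f ig).
(* Fubini's theorem only makes almost every section integrable. *)
- have := @ae_integrable2 _ _ _ T1 R leb2 leb f ig.
  by apply: filterS => z iz _; exact: h.
Qed.

Lemma integral_lines (f : T1 * T1 * T1 -> \bar R) :
  (@volume R).-integrable setT f ->
  (forall xy, \int[leb]_z f (xy, z) = 0)%E ->
  (\int[volume]_x f x = 0)%E.
Proof.
move=> ig h.
have E := @integral12_prod_meas1 _ _ _ T1 R leb2 leb f ig.
by rewrite /volume -E; apply: integral0_eq => xy _; exact: h.
Qed.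

Lemma line_integral_derivative0 (F g : R -> R) (N : R) : 0 < N ->
  (forall t : R, is_derive t 1 F (g t)) -> continuous g ->
  (forall t, ~~ (- N <= t <= N) -> F t = 0) ->
  (forall t, ~~ (- N <= t <= N) -> g t = 0) ->
  (\int[leb]_t (g t)%:E = 0)%E.
Proof.
move=> N0 dF cg F0 g0; pose a := - N - 1; pose b := N + 1.
have -> : (\int[leb]_t (g t)%:E = \int[leb]_(t in `[a, b]) (g t)%:E)%E.
  rewrite [RHS]integral_mkcond; apply: eq_integral => t _; rewrite patchE.
  case: ifPn => //; rewrite notin_setE /= in_itv /= => h.
  by rewrite g0 //; apply: contra_notN h => /andP[? ?]; rewrite /a /b; lra.
have cF : continuous F.
  by move=> t; apply/differentiable_continuous/derivable1_diffP; have [] := dF t.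
rewrite (@continuous_FTC2 R g F a b).
- by rewrite !F0 ?subee // /a /b; lra.
- by rewrite /a /b; lra.
- exact: continuous_subspaceT.
- split; first by move=> t _; have [] := dF t.
    exact/cvg_at_right_filter/cF.
  exact/cvg_at_left_filter/cF.
- by move=> t _; rewrite derive1E; have [] := dF t.
Qed.

Lemma add_scale_unit_vector i (h a b c : R) : h *: ev i + (a, b, c) =
  (h * (val i == 0%N)%:R + a, h * (val i == 1%N)%:R + b,
   h * (val i == 2%N)%:R + c).
Proof. by []. Qed.

(** The divergence theorem for compact supports: with the [i]-th variable
    integrated first, the fundamental theorem of calculus gives zero on each line. *)
Lemma integral_partial0 i (F g : V -> R) (K : set V) : compact K ->
  (forall x, is_derive x (ev i) F (g x)) -> continuous g ->
  (forall x, ~ K x -> F x = 0) -> (forall x, ~ K x -> g x = 0) ->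
  (\int[volume]_x (g x)%:E = 0)%E.
Proof.
move=> cK dF cg F0 g0; have [N N0 KN] := compact_in_box cK.
have section_continuous (s : R -> V) : continuous s -> continuous (g \o s).
  by move=> cs t; apply: continuous_comp; [exact: cs|exact: cg].
have section_derive (s : R -> V) t :
    (forall h, s (h + t) = h *: ev i + s t) -> is_derive t 1 (F \o s) ((g \o s) t).
  move=> sE; apply/is_derive_lineP; have /is_derive_lineP := dF (s t).
  rewrite (_ : (fun h : R => F (h *: ev i + s t)) =
    (fun h : R => (F \o s) (h *: (1 : R) + t))) //.
  by apply/funext => h /=; rewrite -sE /GRing.scale /= mulr1.
have out (s : R -> V) t (G : V -> R) : coord i (s t) = t ->
    (forall x, ~ K x -> G x = 0) -> ~~ (- N <= t <= N) -> G (s t) = 0.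
  move=> st G0 tN; apply: G0 => /KN[]; move: st tN; rewrite /coord.
  by case: i {dF section_derive} => [[|[|[|//]]] ?] /= -> /negP tN ? ? ?; exact: tN.
have section0 (s : R -> V) : continuous s -> (forall t, coord i (s t) = t) ->
    (forall t h, s (h + t) = h *: ev i + s t) ->
    (\int[leb]_t (g (s t))%:E = 0)%E.
  move=> cs sK sD; apply: (@line_integral_derivative0 (F \o s) (g \o s) N) => //.
  - by move=> t; exact: section_derive.
  - exact: section_continuous.
  - by move=> t; exact: (out s t F (sK t)).
  - by move=> t; exact: (out s t g (sK t)).
have ig := compact_support_integrable cg cK g0.
have cc (T : topologicalType) (a : T) : continuous (fun _ : R => a).
  by move=> t; exact: cvg_cst.
have pair_continuous (s1 : R -> R * R) (s2 : R -> R) :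
    continuous s1 -> continuous s2 -> continuous (fun t => (s1 t, s2 t)).
  by move=> c1 c2 t; exact: (cvg_pair (c1 t) (c2 t)).
have pair_continuous2 (s1 s2 : R -> R) :
    continuous s1 -> continuous s2 -> continuous (fun t => (s1 t, s2 t)).
  by move=> c1 c2 t; exact: (cvg_pair (c1 t) (c2 t)).
have pairT_continuous (s1 : R -> R * R) (s2 : R -> R) :
    continuous s1 -> continuous s2 -> continuous (fun t => (s1 t, s2 t)).
  by move=> c1 c2 t; exact: (cvg_pair (c1 t) (c2 t)).
have ci : continuous (fun t : R => t) by move=> t; exact: cvg_id.
case: i dF section_derive out section0 => [[|[|[|//]]] ?] dF _ _ section0.
- apply: (integral_planes ig) => z iz; rewrite -(@integral21_prod_meas1 _ _ T1 T1 R leb leb _ iz).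
  apply: integral0_eq => y _; apply: (section0 (fun t => ((t, y), z))) => //.
    by apply: pair_continuous; [apply: pair_continuous2|exact: cc] => //; exact: cc.
  by move=> t h; rewrite add_scale_unit_vector /= mulr1 !mulr0 !add0r.
- apply: (integral_planes ig) => z iz; rewrite -(@integral12_prod_meas1 _ _ T1 T1 R leb leb _ iz).
  apply: integral0_eq => x _; apply: (section0 (fun t => ((x, t), z))) => //.
    by apply: pair_continuous; [apply: pair_continuous2|exact: cc] => //; exact: cc.
  by move=> t h; rewrite add_scale_unit_vector /= mulr1 !mulr0 !add0r.
- apply: (integral_lines ig) => x; apply: (section0 (fun t => (x, t))) => //.
    by apply: pairT_continuous => //; exact: cc.
  move=> t h; case: x => a b.
  by rewrite add_scale_unit_vector /= mulr1 !mulr0 !add0r.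
Qed.

End divergence.

(** * Square-integrable functions as a prehilbert space *)

Section L2_space.
Context {R : realType}.
Local Notation V := (R * R * R)%type.
Local Notation M := (measurableTypeR R * measurableTypeR R * measurableTypeR R)%type.
Variable O : set V.
Hypothesis mO : measurable (O : set M).
Implicit Types f g h u : V -> R.
Local Notation inner := (L2_inner O).

Lemma L2_measurable f : L2 O f -> measurable_fun (O : set M) (f : M -> R).
Proof.
move=> /andP[mf _]; move: mf; rewrite inE /= => mf.
exact/(measurable_restrictT _ mO).
Qed.

Lemma L2_sqr_integrable f : L2 O f ->
  (@volume R).-integrable O (fun x => (f x ^+ 2)%:E).
Proof.
move=> /Lfun2_integrable_sqr; rewrite (integrable_mkcond _ mO).
congr (integrable _ _); apply/funext => x /=; rewrite !patchE.
by case: ifP => //; rewrite expr0n.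
Qed.

Lemma L2_of_integrable f : measurable_fun (O : set M) (f : M -> R) ->
  (@volume R).-integrable O (fun x => (f x ^+ 2)%:E) -> L2 O f.
Proof.
move=> mf /integrableP[mf2 if2]; apply/andP; split.
  by rewrite inE /=; exact/(measurable_restrictT _ mO).
rewrite inE /= /finite_norm unlock /Lnorm poweR_lty //.
apply: le_lt_trans if2; rewrite [leRHS]integral_mkcond le_eqVlt; apply/orP; left.
apply/eqP; apply: eq_integral => x _ /=; rewrite !patchE.
case: ifP => _ /=; first by rewrite powR_mulrn // -normrX.
by rewrite normr0 powR0 // pnatr_eq0.
Qed.

Lemma L2_add f g : L2 O f -> L2 O g -> L2 O (f \+ g).
Proof.
move=> Lf Lg; rewrite /L2 /= (_ : (f \+ g) \_ O = f \_ O + g \_ O).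
  by apply: (Lfun_addr_closed volume _).2 => //; rewrite lee_fin ler1n.
apply/funext => x; rewrite -[RHS]/((f \_ O) x + (g \_ O) x) !patchE.
by case: ifP => // _; rewrite addr0.
Qed.

Lemma L2_scale c f : L2 O f -> L2 O (fun x => c * f x).
Proof.
move=> Lf; rewrite /L2 /= (_ : _ \_ O = c \o* (f \_ O)).
  by apply: Lfun_scale => //; rewrite ler1n.
apply/funext => x; rewrite /= !patchE.
by case: ifP => // _; rewrite ?mul0r // mulrC.
Qed.

Lemma L2_opp f : L2 O f -> L2 O (fun x => - f x).
Proof.
by move=> /(L2_scale (-1)); congr (L2 O _); apply/funext => x; rewrite mulN1r.
Qed.

Lemma L2_sub f g : L2 O f -> L2 O g -> L2 O (f \- g).
Proof. by move=> Lf Lg; exact: (L2_add Lf (L2_opp Lg)). Qed.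

Lemma L2_mul_integrable f g : L2 O f -> L2 O g ->
  (@volume R).-integrable O (fun x => (f x * g x)%:E).
Proof.
move=> Lf Lg; have := Lfun2_mul_Lfun1 Lf Lg => /Lfun1_integrable.
rewrite (integrable_mkcond _ mO).
congr (integrable _ _); apply/funext => x /=; rewrite !patchE.
by case: ifP => //; rewrite mulr0.
Qed.

Lemma eq_L2_inner f g f' g' : (forall x, O x -> f x * g x = f' x * g' x) ->
  inner f g = inner f' g'.
Proof. by move=> E; apply: eq_Rintegral => x; rewrite inE => /E. Qed.

Lemma L2_innerC f g : inner f g = inner g f.
Proof. by apply: eq_L2_inner => x _; rewrite mulrC. Qed.

Lemma L2_innerDl f g h : L2 O f -> L2 O g -> L2 O h ->
  inner (f \+ g) h = inner f h + inner g h.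
Proof.
move=> Lf Lg Lh; rewrite -RintegralD //; try exact: L2_mul_integrable.
by apply: eq_Rintegral => x _; rewrite mulrDl.
Qed.

Lemma L2_innerZl c f h : L2 O f -> L2 O h ->
  inner (fun x => c * f x) h = c * inner f h.
Proof.
move=> Lf Lh; rewrite -RintegralZl //; try exact: L2_mul_integrable.
by apply: eq_Rintegral => x _; rewrite mulrA.
Qed.

Lemma L2_innerBl f g h : L2 O f -> L2 O g -> L2 O h ->
  inner (f \- g) h = inner f h - inner g h.
Proof.
move=> Lf Lg Lh; rewrite -RintegralB //; try exact: L2_mul_integrable.
by apply: eq_Rintegral => x _; rewrite mulrBl.
Qed.

Lemma L2_innerDr f g h : L2 O f -> L2 O g -> L2 O h ->
  inner h (f \+ g) = inner h f + inner h g.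
Proof. by move=> *; rewrite ![inner h _]L2_innerC L2_innerDl. Qed.

Lemma L2_innerBr f g h : L2 O f -> L2 O g -> L2 O h ->
  inner h (f \- g) = inner h f - inner h g.
Proof. by move=> *; rewrite ![inner h _]L2_innerC L2_innerBl. Qed.

Lemma L2_innerZr c f h : L2 O f -> L2 O h ->
  inner h (fun x => c * f x) = c * inner h f.
Proof. by move=> *; rewrite ![inner h _]L2_innerC L2_innerZl. Qed.

Lemma L2_inner_ge0 f : 0 <= inner f f.
Proof. by apply: Rintegral_ge0 => x _; rewrite -expr2 sqr_ge0. Qed.

Lemma L2_sub_sqr f g : L2 O f -> L2 O g ->
  inner (f \- g) (f \- g) = inner f f - 2 * inner f g + inner g g.
Proof.
move=> Lf Lg; have Lfg := L2_sub Lf Lg.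
by rewrite L2_innerBl // !L2_innerBr // (L2_innerC g f); ring.
Qed.

Definition L2_norm f := Num.sqrt (inner f f).

Lemma L2_norm_ge0 f : 0 <= L2_norm f. Proof. exact: sqrtr_ge0. Qed.

Lemma sqr_L2_norm f : L2_norm f ^+ 2 = inner f f.
Proof. by rewrite sqr_sqrtr // L2_inner_ge0. Qed.

(** The quadratic polynomial [t |-> inner (f - t g) (f - t g)] is nonnegative. *)
Lemma cauchy_schwarz f g : L2 O f -> L2 O g ->
  `|inner f g| <= L2_norm f * L2_norm g.
Proof.
move=> Lf Lg; rewrite -ler_sqr ?nnegrE ?mulr_ge0 ?L2_norm_ge0 //.
rewrite exprMn !sqr_L2_norm real_normK ?num_real //.
have quad (t : R) : 0 <= inner f f - 2 * (t * inner f g) + t ^+ 2 * inner g g.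
  have Ltg := L2_scale t Lg.
  have := L2_inner_ge0 (f \- (fun x => t * g x)).
  by rewrite L2_sub_sqr // L2_innerZr // L2_innerZl // L2_innerZr //; nra.
set a := inner f f in quad *; set b := inner f g in quad *.
set c := inner g g in quad *.
have a0 : 0 <= a by exact: L2_inner_ge0.
have := L2_inner_ge0 g; rewrite -/c le_eqVlt => /predU1P[c0|c0].
  have [->|b0] := eqVneq b 0; first by rewrite expr0n /= -c0 mulr0.
  have := quad ((a + 1) / (2 * b)); rewrite -c0 mulr0 addr0.
  have -> : 2 * ((a + 1) / (2 * b) * b) = a + 1 by field.
  by lra.
have := quad (b / c).
have -> : a - 2 * (b / c * b) + (b / c) ^+ 2 * c = (a * c - b ^+ 2) / c.
  by field; rewrite gt_eqF.
by rewrite pmulr_lge0 ?invr_gt0 // subr_ge0.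
Qed.

Lemma L2_cvgP (v : (V -> R)^nat) u : (forall n, L2 O (v n)) -> L2 O u ->
  L2_cvg O v u <-> (L2_norm (v n \- u) @[n --> \oo] --> 0).
Proof.
move=> Lv Lu.
have E n : ('N[volume]_2%:E[EFin \o ((v n \- u)%R \_ O)] = (L2_norm (v n \- u))%:E)%E.
  have Lvu := L2_sub (Lv n) Lu.
  rewrite unlock /Lnorm /= (_ : (\int[_]_x _ = (inner (v n \- u) (v n \- u))%:E)%E).
    by rewrite poweR_EFin /L2_norm powR12_sqrt ?L2_inner_ge0.
  rewrite /L2_inner /Rintegral fineK; last first.
    exact/integrable_fin_num/L2_mul_integrable.
  rewrite [RHS]integral_mkcond; apply: eq_integral => x _ /=; rewrite !patchE.
  case: ifP => _ /=; last by rewrite normr0 powR0 // pnatr_eq0.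
  by rewrite powR_mulrn // -normrX ger0_norm ?sqr_ge0 // expr2.
rewrite /L2_cvg; under eq_fun do rewrite E.
split=> [/fine_cvgP[_]|h]; first by [].
exact: cvg_EFin (nearW _ _) h.
Qed.

Lemma L2_inner_cvg (v : (V -> R)^nat) u g : (forall n, L2 O (v n)) -> L2 O u ->
  L2_cvg O v u -> L2 O g -> inner (v n) g @[n --> \oo] --> inner u g.
Proof.
move=> Lv Lu /(L2_cvgP Lv Lu) vu Lg; apply/subr_cvg0.
apply: norm_cvg0.
apply: (@squeeze_cvgr _ _ _ _ (cst 0) (fun n => L2_norm (v n \- u) * L2_norm g)).
- apply: nearW => n; rewrite normr_ge0 -L2_innerBl //=; apply: cauchy_schwarz => //.
  exact: L2_sub.
- exact: cvg_cst.
- by rewrite -[X in _ --> X](mul0r (L2_norm g)); apply: cvgM => //; exact: cvg_cst.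
Qed.

Lemma L2_sqr_cvg (v : (V -> R)^nat) u : (forall n, L2 O (v n)) -> L2 O u ->
  L2_cvg O v u -> inner (v n) (v n) @[n --> \oo] --> inner u u.
Proof.
move=> Lv Lu vu; have vu0 := (L2_cvgP Lv Lu).1 vu.
have -> : (fun n => inner (v n) (v n)) =
   (fun n => L2_norm (v n \- u) ^+ 2 + 2 * inner (v n) u - inner u u).
  by apply/funext => n; rewrite sqr_L2_norm L2_sub_sqr //; ring.
rewrite [X in _ --> X](_ : _ = 0 ^+ 2 + 2 * inner u u - inner u u); last by ring.
apply: cvgB; last exact: cvg_cst.
apply: cvgD; first by under eq_fun do rewrite expr2; rewrite expr2; exact: cvgM.
by apply: cvgM; [exact: cvg_cst|exact: L2_inner_cvg].
Qed.

Lemma L2_bounded f (N : R) : (volume (O : set M) < +oo)%E ->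
  measurable_fun (O : set M) (f : M -> R) -> (forall x, O x -> `|f x| <= N) -> L2 O f.
Proof.
move=> O8 mf fN; apply: L2_of_integrable => //.
apply: (@bounded_integrable _ _ _ (N ^+ 2)) => //.
  by under eq_fun do rewrite expr2; exact: measurable_funM.
move=> x Ox; rewrite normrX lerXn2r ?nnegrE //; last exact: fN.
exact: le_trans (normr_ge0 _) (fN _ Ox).
Qed.

(** Dominated convergence on a domain of finite volume *)
Lemma L2_cvg_bounded (v : (V -> R)^nat) u (N : R) :
  (volume (O : set M) < +oo)%E -> (forall n, L2 O (v n)) -> L2 O u ->
  (forall n x, O x -> `|v n x - u x| <= N) ->
  (forall x, O x -> v n x @[n --> \oo] --> u x) -> L2_cvg O v u.
Proof.
move=> O8 Lv Lu vN vu; apply/L2_cvgP => //.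
pose d n (x : M) := ((v n x - u x) * (v n x - u x))%:E.
have id n : (@volume R).-integrable O (d n).
  by apply: L2_mul_integrable; exact: L2_sub.
have iN : (@volume R).-integrable O (fun=> (N ^+ 2)%:E).
  apply: (@bounded_integrable _ O (fun=> N ^+ 2) (`|N ^+ 2|)) => //.
have dN : {ae @volume R, forall x n, O x -> (`|d n x| <= (N ^+ 2)%:E)%E}.
  apply: aeW => x n Ox; rewrite /d lee_fin -expr2 normrX.
  by rewrite lerXn2r ?nnegrE // ?vN // (le_trans (normr_ge0 _) (vN n x Ox)).
have d0 : {ae @volume R, forall x, O x -> d ^~ x @ \oo --> (cst 0%E : M -> \bar R) x}.
  apply: aeW => x Ox; apply: cvg_EFin; first exact: nearW.
  have /subr_cvg0 h := vu x Ox.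
  by rewrite -[X in _ --> X](mul0r (0 : R)); exact: cvgM.
have [_ _] := @dominated_convergence _ _ _ (@volume R) O mO d (cst 0%E)
  (fun=> (N ^+ 2)%:E) (fun n => measurable_int _ (id n)) (measurable_cst _)
  d0 iN dN.
rewrite integral0 => /fine_cvgP[_] h.
rewrite -[X in _ --> X]sqrtr0; apply: continuous_cvg h.
exact: sqrt_continuous.
Qed.

End L2_space.

(** * Functions orthogonal to all tensor products of bumps *)

Section dynkin.
Context {R : realType}.
Local Notation V := (R * R * R)%type.
Local Notation T1 := (measurableTypeR R).
Local Notation M := (T1 * T1 * T1)%type.

(** Dynkin's theorem for the signed measure of density [g], transported by [f]. *)
Lemma integral0_generated d (T : measurableType d) (G : set (set T)) (S : set M)
    (g : M -> \bar R) (f : M -> T) :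
  measurable S -> (@volume R).-integrable S g -> measurable_fun setT f ->
  @measurable _ T = <<s G >> -> setI_closed G ->
  (\int[volume]_(x in S) g x = 0)%E ->
  (forall A, G A -> \int[volume]_(x in S `&` f @^-1` A) g x = 0)%E ->
  forall A, measurable A -> (\int[volume]_(x in S `&` f @^-1` A) g x = 0)%E.
Proof.
move=> mS ig mf mE GI gS0 gG A mA.
have mP (B : set T) : measurable B -> measurable (S `&` f @^-1` B).
  by move=> mB; apply: measurableI => //; rewrite -[X in measurable X]setTI; exact: mf.
have iP (B : set M) : measurable B -> B `<=` S -> (@volume R).-integrable B g.
  by move=> mB BS; exact: integrableS ig.
apply: (@dynkin_induction _ T G
  (fun A => \int[volume]_(x in S `&` f @^-1` A) g x = 0)%E) => //.
- by rewrite preimage_setT setIT.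
- move=> B mB gB; have := gS0.
  have -> : S = (S `&` f @^-1` B) `|` (S `&` f @^-1` (~` B)).
    by rewrite -setIUr preimage_setC setUv setIT.
  rewrite integral_setU.
  + by rewrite gB add0e -setIUr preimage_setC setUv setIT.
  + exact: mP.
  + by apply: mP; exact: measurableC.
  + rewrite -setIUr preimage_setC setUv setIT; exact: measurable_int ig.
  + by apply/disj_setPS => x [[_ Bx] [_ nBx]].
- move=> F mF tF gF; rewrite preimage_bigcup setI_bigcupr integral_bigcup.
  + by apply: eseries0 => i _ _; exact: gF.
  + apply/trivIsetP => i j _ _ ij; rewrite setIACA setIid -preimage_setI.
    by move/trivIsetP : tF => /(_ i j I I ij) ->; rewrite preimage_set0 setI0.
  + by move=> k; exact: mP.
  + apply: iP; first by apply: bigcup_measurable => k _; exact: mP.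
    by move=> x [k _ []].
- by rewrite -mE.
Qed.

(** Open intervals are replaced by Borel sets in one coordinate after the other;
    then rectangles by planar Borel sets, and cylinders by Borel sets of space. *)
Lemma integral0_boxes (p q : V) (g : M -> \bar R) :
  (@volume R).-integrable (obox p q) g ->
  (forall p' q', \int[volume]_(x in obox p q `&` obox p' q') g x = 0)%E ->
  forall E : set M, measurable E -> (\int[volume]_(x in obox p q `&` E) g x = 0)%E.
Proof.
move=> ig g0.
have mS : measurable (obox p q : set M) by exact: measurable_obox.
pose G1 : set (set R) := [set A | exists x y, A = `]x, y[%classic].
have mG1 : @measurable _ T1 = <<s G1 >> by exact: RGenOpens.measurableE.
have G1I : setI_closed G1.
  move=> _ _ [a [b ->]] [c [e ->]]; exists (Num.max a c), (Num.min b e).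
  apply/seteqP; split=> t /=; rewrite !in_itv /= gt_max lt_min.
    by move=> [/andP[-> ->] /andP[-> ->]].
  by move=> /andP[/andP[-> ->] /andP[-> ->]].
have mG1' A : G1 A -> measurable (A : set T1).
  by move=> GA; rewrite mG1; exact: sub_gen_smallest.
have mx : measurable_fun setT (fun x : M => x.1.1).
  by apply: measurableT_comp => //; exact: measurable_fst.
have my : measurable_fun setT (fun x : M => x.1.2).
  by apply: measurableT_comp => //; exact: measurable_fst.
have mz : measurable_fun setT (fun x : M => x.2) by exact: measurable_snd.
have mpre (f : M -> T1) A : measurable_fun setT f -> measurable A ->
    measurable (f @^-1` A).
  by move=> mf mA; rewrite -[X in measurable X]setTI; exact: mf.
have iS (B : set M) : measurable B -> (@volume R).-integrable (obox p q `&` B) g.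
  move=> mB; apply: integrableS ig => //; exact: measurableI.
pose X A := (fun x : M => x.1.1) @^-1` A.
pose Y A := (fun x : M => x.1.2) @^-1` A.
pose Z A := (fun x : M => x.2) @^-1` A.
have mX A : measurable A -> measurable (X A) by exact: mpre.
have mY A : measurable A -> measurable (Y A) by exact: mpre.
have mZ A : measurable A -> measurable (Z A) by exact: mpre.
pose I := `]p.1.1, q.1.1[%classic; pose J := `]p.1.2, q.1.2[%classic.
pose K := `]p.2, q.2[%classic.
have SI : obox p q `<=` X I.
  by move=> x [h _ _]; rewrite /X /I /= in_itv /=.
have SJ : obox p q `<=` Y J.
  by move=> x [_ h _]; rewrite /Y /J /= in_itv /=.
have SK : obox p q `<=` Z K.
  by move=> x [_ _ h]; rewrite /Z /K /= in_itv /=.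
have step0 A B C : G1 A -> G1 B -> G1 C ->
    (\int[volume]_(x in obox p q `&` (Y B `&` Z C) `&` X A) g x = 0)%E.
  move=> [a1 [b1 ->]] [a2 [b2 ->]] [a3 [b3 ->]].
  rewrite -(g0 (a1, a2, a3) (b1, b2, b3)); congr (integral _ _ _).
  rewrite -setIA; congr (_ `&` _).
  apply/seteqP; split=> x; rewrite /X /Y /Z /obox /= !in_itv /=.
    by move=> [[? ?] ?].
  by move=> [? ? ?].
have GI : G1 I by exists p.1.1, q.1.1.
have GJ : G1 J by exists p.1.2, q.1.2.
have GK : G1 K by exists p.2, q.2.
have step1 A B C : measurable A -> G1 B -> G1 C ->
    (\int[volume]_(x in obox p q `&` (Y B `&` Z C) `&` X A) g x = 0)%E.
  move=> mA GB GC; apply: (integral0_generated _ _ mx mG1) => //.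
  - by apply: measurableI => //; apply: measurableI; [apply: mY|apply: mZ]; exact: mG1'.
  - by apply: iS; apply: measurableI; [apply: mY|apply: mZ]; exact: mG1'.
  - rewrite -(step0 I B C) //; congr (integral _ _ _).
    by apply/esym/setIidPl => x [Sx _]; exact: SI.
  - by move=> D GD; exact: step0.
have step2 A B C : measurable A -> measurable B -> G1 C ->
    (\int[volume]_(x in obox p q `&` (X A `&` Z C) `&` Y B) g x = 0)%E.
  move=> mA mB GC.
  have mC := mG1' _ GC.
  apply: (integral0_generated _ _ my mG1) => //.
  - by apply: measurableI => //; apply: measurableI; [apply: mX|apply: mZ].
  - by apply: iS; apply: measurableI; [apply: mX|apply: mZ].
  - rewrite -(step1 A J C) //; congr (integral _ _ _).
    apply/seteqP; split=> x.
      by move=> [Sx [? ?]]; split => //; split => //; split => //; exact: SJ.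
    by move=> [[Sx [? ?]] ?]; split.
  - move=> D GD; rewrite -(step1 A D C) //; congr (integral _ _ _).
    by apply/seteqP; split=> x [[? [? ?]] ?].
have step3 A B C : measurable A -> measurable B -> measurable C ->
    (\int[volume]_(x in obox p q `&` (X A `&` Y B) `&` Z C) g x = 0)%E.
  move=> mA mB mC.
  apply: (integral0_generated _ _ mz mG1) => //.
  - by apply: measurableI => //; apply: measurableI; [apply: mX|apply: mY].
  - by apply: iS; apply: measurableI; [apply: mX|apply: mY].
  - rewrite -(step2 A B K) //; congr (integral _ _ _).
    apply/seteqP; split=> x.
      by move=> [Sx [? ?]]; split => //; split => //; split => //; exact: SK.
    by move=> [[Sx [? ?]] ?]; split.
  - move=> D GD; rewrite -(step2 A B D) //; congr (integral _ _ _).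
    by apply/seteqP; split=> x [[? [? ?]] ?].
have prodI (d1 d2 : measure_display) (U1 : measurableType d1)
    (U2 : measurableType d2) : setI_closed
    [set A `*` B | A in @measurable _ U1 & B in @measurable _ U2].
  move=> _ _ [A1 mA1 [A2 mA2 <-]] [B1 mB1 [B2 mB2 <-]].
  exists (A1 `&` B1); first exact: measurableI.
  exists (A2 `&` B2); first exact: measurableI.
  by rewrite setXI.
have step4 (D : set (T1 * T1)) C : measurable D -> measurable C ->
    (\int[volume]_(x in obox p q `&` Z C `&` fst @^-1` D) g x = 0)%E.
  move=> mD mC.
  apply: (integral0_generated _ _ measurable_fst
    (@measurable_prod_measurableType _ _ T1 T1) (@prodI _ _ T1 T1)) => //.
  - by apply: measurableI => //; exact: mZ.
  - by apply: iS; exact: mZ.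
  - rewrite -(step3 setT setT C) //; congr (integral _ _ _).
    by rewrite /X /Y !preimage_setT !setIT.
  - move=> _ [A mA [B mB <-]]; rewrite -(step3 A B C) //; congr (integral _ _ _).
    by apply/seteqP; split=> x; rewrite /X /Y /Z /=;
      [case=> [[? ?] [? ?]]|case=> [[? [? ?]] ?]].
move=> E mE; apply: (@integral0_generated _ M _ (obox p q) g id _ _ _
    (@measurable_prod_measurableType _ _ _ T1) (@prodI _ _ _ T1)) => //.
- rewrite -(step4 setT setT) //; congr (integral _ _ _).
  by rewrite /Z !preimage_setT !setIT.
- move=> _ [D mD [C mC <-]]; rewrite -(step4 D C) //; congr (integral _ _ _).
  by apply/seteqP; split=> x; rewrite /Z /=; [case=> ? [? ?]|case=> [[? ?] ?]].
Qed.

End dynkin.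

Section one_dimensional_tests.
Context {R : realType}.
Implicit Types (p q : R) (w : R -> R).

Lemma flat_le k (t : R) : flat k t <= k.+1%:R ^+ k.+1.
Proof.
have [t1|t1] := leP t 1; last first.
  have t0 : 0 < t by apply: lt_trans t1.
  rewrite /flat t0; apply: (@le_trans _ _ 1); last first.
    by rewrite exprn_ege1 // ler1n.
  rewrite mulr_ile1 ?exprn_ge0 ?expR_ge0 ?invr_ge0 ?(ltW t0) //.
    by rewrite exprn_ile1 ?invr_ge0 ?(ltW t0) // invf_le1 // ltW.
  by rewrite -expR0 ler_expR oppr_le0 invr_ge0 ltW.
have [t0|t0] := leP t 0; first by rewrite flat_le0 // exprn_ge0.
apply: le_trans (flat_bound k t) _; rewrite gtr0_norm //.
by rewrite ger_pMr // exprn_gt0 // ltr0n.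
Qed.

Lemma cvg_affine_pinfty (c : R) : 0 < c -> (n%:R * c - 1) @[n --> \oo] --> +oo.
Proof.
move=> c0; apply/cvgryPge => A; near=> n; rewrite lerBrDr.
rewrite -ler_pdivrMr //; near: n; exact: nbhs_infty_ger.
Unshelve. all: by end_near. Qed.

Lemma flat0_cvg (s : R^nat) : s n @[n --> \oo] --> +oo ->
  flat 0 (s n) @[n --> \oo] --> (1 : R).
Proof.
move=> sy.
have inv0 : (s n)^-1 @[n --> \oo] --> (0 : R).
  by apply/gtr0_cvgV0 => //; near=> n; near: n; exact: (cvgry_gt sy).
have : expR (- (s n)^-1) @[n --> \oo] --> (1 : R).
  rewrite -[X in _ --> X](@expR0 R) -[X in expR X]oppr0.
  by apply: continuous_cvg; [exact: continuous_expR|exact: cvgN].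
apply: cvg_trans; apply: near_eq_cvg.
by near=> n; rewrite /flat ifT ?expr0 ?mul1r //; near: n; exact: (cvgry_gt sy).
Unshelve. all: by end_near. Qed.

Lemma flatS_cvg k (s : R^nat) : s n @[n --> \oo] --> +oo ->
  flat k.+1 (s n) @[n --> \oo] --> (0 : R).
Proof.
move=> sy.
have inv0 : (s n)^-1 @[n --> \oo] --> (0 : R).
  by apply/gtr0_cvgV0 => //; near=> n; near: n; exact: (cvgry_gt sy).
have h : (s n)^-1 * (k.+1%:R ^+ k.+1) @[n --> \oo] --> (0 : R).
  by rewrite -[X in _ --> X](mul0r (k.+1%:R ^+ k.+1)); apply: cvgM => //; exact: cvg_cst.
apply: (@squeeze_cvgr _ _ _ _ (cst 0) _ _ _ _ _ h); last exact: cvg_cst.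
near=> n; rewrite flat_ge0 /=.
have s0 : 0 < s n by near: n; exact: (cvgry_gt sy).
rewrite ler_pdivlMl // mulrC -flat_mul; exact: flat_le.
Unshelve. all: by end_near. Qed.

Definition test1 p q w : Prop := (forall n, Ck1 n setT w) /\
  exists a b, [/\ p < a, b < q & forall t, ~~ (a <= t <= b) -> w t = 0].

(** A compactly supported approximation of the indicator of the interval from
    [p] to [q]. *)
Definition bump p q (n : nat) (t : R) : R :=
  flat 0 (n%:R * (t - p) - 1) * flat 0 (n%:R * (q - t) - 1).

Lemma Ck1_flat_affine n k (c d : R) : Ck1 n setT (fun t => flat k (c * t + d)).
Proof.
apply: (@Ck_comp _ _ _ _ n setT setT (flat k) (fun t => c * t + d)) => //.
  exact: Ck1_flat.
by apply: CkD; [apply: CkZ; exact: Ck1_id|exact: Ck_cst].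
Qed.

Lemma bump_test1 p q n : test1 p q (bump p q n.+1).
Proof.
split.
  move=> m; have -> : bump p q n.+1 =
      (fun t => flat 0 (n.+1%:R * t + (- (n.+1%:R * p) - 1))) \*
      (fun t => flat 0 (- n.+1%:R * t + (n.+1%:R * q - 1))).
    by apply/funext => t; rewrite /bump /=; congr (flat 0 _ * flat 0 _); ring.
  by apply: CkM; exact: Ck1_flat_affine.
have n0 : 0 < n.+1%:R :> R by rewrite ltr0n.
exists (p + n.+1%:R^-1), (q - n.+1%:R^-1); split.
- by rewrite ltrDl invr_gt0.
- by rewrite gtrBl invr_gt0.
move=> t; rewrite negb_and -!ltNge /bump => /orP[h|h].
  rewrite flat_le0 ?mul0r // subr_le0 -ler_pdivlMl // mulr1 lerBlDl.
  exact: ltW.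
rewrite [X in _ * X]flat_le0 ?mulr0 // subr_le0 -ler_pdivlMl // mulr1 lerBlDl -lerBlDr.
exact: ltW.
Qed.

Lemma bump_ge0 p q n t : 0 <= bump p q n t.
Proof. by rewrite mulr_ge0 // flat_ge0. Qed.

Lemma bump_le1 p q n t : bump p q n t <= 1.
Proof. by rewrite mulr_ile1 // ?flat_ge0 // flat0_le1. Qed.

Lemma bump_out p q n t : ~~ (p < t < q) -> bump p q n t = 0.
Proof.
rewrite negb_and -!leNgt /bump => /orP[h|h].
  by rewrite flat_le0 ?mul0r // subr_le0 (@le_trans _ _ 0) // mulr_ge0_le0 // subr_le0.
by rewrite [X in _ * X]flat_le0 ?mulr0 // subr_le0 (@le_trans _ _ 0) // mulr_ge0_le0 // subr_le0.
Qed.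

Lemma bump_cvg p q t : bump p q n.+1 t @[n --> \oo] --> ((p < t < q)%R%:R : R).
Proof.
have [/andP[pt tq]|h] := boolP (p < t < q); last first.
  by under eq_fun do rewrite bump_out //; exact: cvg_cst.
have h : bump p q n t @[n --> \oo] --> (1 : R).
  rewrite -[X in _ --> X](mulr1 1).
  by apply: cvgM; apply: flat0_cvg; apply: cvg_affine_pinfty; rewrite subr_gt0.
by rewrite -cvg_shiftS in h.
Qed.

End one_dimensional_tests.

Section tensor.
Context {R : realType}.
Local Notation V := (R * R * R)%type.
Local Notation M := (measurableTypeR R * measurableTypeR R * measurableTypeR R)%type.
Local Notation ev := (@unit_vector R).
Implicit Types (p q : V) (w : 'I_3 -> R -> R).

Definition tensor w (x : V) : R := \prod_(i < 3) w i (coord i x).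

Definition tests p q w : Prop := forall i, test1 (coord i p) (coord i q) (w i).

Definition upd w (i : 'I_3) (f : R -> R) : 'I_3 -> R -> R :=
  fun j => if j == i then f else w j.

Lemma oboxP p q (x : V) :
  obox p q x <-> forall i, coord i p < coord i x < coord i q.
Proof.
split=> [[a b c] [[|[|[|//]]] ?] //|h]; split.
- exact: (h (@Ordinal 3 0 isT)).
- exact: (h (@Ordinal 3 1 isT)).
- exact: (h (@Ordinal 3 2 isT)).
Qed.

Lemma cboxP p q (x : V) :
  cbox p q x <-> forall i, coord i p <= coord i x <= coord i q.
Proof.
split=> [[a b c] [[|[|[|//]]] ?] //|h]; split.
- exact: (h (@Ordinal 3 0 isT)).
- exact: (h (@Ordinal 3 1 isT)).
- exact: (h (@Ordinal 3 2 isT)).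
Qed.

Definition point_of (f : 'I_3 -> R) : V :=
  (f (@Ordinal 3 0 isT), f (@Ordinal 3 1 isT), f (@Ordinal 3 2 isT)).

Lemma coord_point_of f i : coord i (point_of f) = f i.
Proof. by case: i => [[|[|[|//]]] h] //=; congr f; exact: val_inj. Qed.

Lemma Ck_tensor w n : (forall i, Ck1 n setT (w i)) -> Ck ev n setT (tensor w).
Proof.
move=> Cw; have C i : Ck ev n setT (w i \o coord i).
  by apply: (@Ck_comp _ _ _ _ n setT setT (w i)) => //; exact: Ck_coord.
have -> : tensor w = (w (@Ordinal 3 0 isT) \o coord (@Ordinal 3 0 isT)) \*
   ((w (@Ordinal 3 1 isT) \o coord (@Ordinal 3 1 isT)) \*
    (w (@Ordinal 3 2 isT) \o coord (@Ordinal 3 2 isT))).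
  apply/funext => x; rewrite /tensor !big_ord_recl big_ord0 mulr1 /=.
  by congr (w _ (coord _ x) * (w _ (coord _ x) * w _ (coord _ x))); exact: val_inj.
by apply: CkM; [|apply: CkM].
Qed.

Lemma tests_support p q w : tests p q w ->
  exists a b, cbox a b `<=` obox p q /\ forall x, ~ cbox a b x -> tensor w x = 0.
Proof.
move=> tw.
have /choice[f hf] : forall i : 'I_3, exists ab : R * R,
    [/\ coord i p < ab.1, ab.2 < coord i q &
      forall t, ~~ (ab.1 <= t <= ab.2) -> w i t = 0].
  by move=> i; have [_ [a [b [? ? ?]]]] := tw i; exists (a, b).
exists (point_of (fun i => (f i).1)), (point_of (fun i => (f i).2)); split.
  move=> x /cboxP h; apply/oboxP => i; have := h i; rewrite !coord_point_of.
  by have [h1 h2 _] := hf i => /andP[h3 h4]; rewrite (lt_le_trans h1) //= (le_lt_trans h4).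
move=> x h.
have [i hi] : exists i, ~~ ((f i).1 <= coord i x <= (f i).2).
  apply: contra_notP h => /forallNP h; apply/cboxP => i; rewrite !coord_point_of.
  exact/negPn/negP/h.
by rewrite /tensor (bigD1 i) //=; have [_ _ ->] := hf i; rewrite ?mul0r.
Qed.

Lemma tensor_test_function p q w : tests p q w -> test_function (obox p q) (tensor w).
Proof.
move=> tw; split.
  by apply/smooth_Ck => n; apply: Ck_tensor => i; exact: (tw i).1.
have [a [b [ab0 h]]] := tests_support tw.
by exists (cbox a b); split => //; exact: compact_cbox.
Qed.

Lemma tests_upd p q w i f : tests p q w -> test1 (coord i p) (coord i q) f ->
  tests p q (upd w i f).
Proof. by move=> tw tf j; rewrite /upd; case: eqP => [->|_]. Qed.

Lemma tensor_upd w i f (x : V) :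
  tensor (upd w i f) x = f (coord i x) * \prod_(j < 3 | j != i) w j (coord j x).
Proof.
rewrite /tensor (bigD1 i) //= /upd eqxx; congr (_ * _).
by apply: eq_bigr => j /negbTE ->.
Qed.

Lemma partial_tensor w i f f' : (forall t : R, is_derive t 1 f (f' t)) ->
  partial [:: i] (tensor (upd w i f)) = tensor (upd w i f').
Proof.
move=> df; apply/funext => x /=.
have dline : is_derive x (ev i) (tensor (upd w i f)) (tensor (upd w i f') x).
  apply/is_derive_lineP.
  pose c := \prod_(j < 3 | j != i) w j (coord j x).
  have E (h : R) : tensor (upd w i f) (h *: ev i + x) = f (h + coord i x) * c.
    rewrite tensor_upd coord_line eqxx mulr1; congr (_ * _); apply: eq_bigr => j ji.
    by rewrite coord_line eq_sym (negbTE ji) mulr0 add0r.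
  rewrite (funext E) tensor_upd -/c.
  have d0 : is_derive (0 : R) 1 (fun h : R => f (h + coord i x)) (f' (coord i x)).
    have /is_derive_lineP := df (coord i x).
    by under eq_fun do rewrite [_%:A]mulr1.
  apply: (is_derive_eq (is_deriveM d0 (is_derive_cst c _ _))).
  by rewrite /GRing.scale /= mulr0 add0r mulrC.
by have [_] := dline.
Qed.

(** Tensor products of bumps converge boundedly to the indicator of any sub-box,
    so [g] has zero integral over all sub-boxes, hence over all Borel subsets. *)
Lemma integral_obox_tensors p q (g : M -> R) :
  (@volume R).-integrable (obox p q) (EFin \o g) ->
  (forall w, tests p q w ->
     \int[volume]_(x in obox p q) (g x * tensor w x)%:E = 0)%E ->
  {ae @volume R, forall x, obox p q x -> g x = 0}.
Proof.
move=> ig g0.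
have mS : measurable (obox p q : set M) by exact: measurable_obox.
have mg := measurable_int _ ig.
have sub0 p' q' : (\int[volume]_(x in obox p q `&` obox p' q') (g x)%:E = 0)%E.
  pose lo i := Num.max (coord i p) (coord i p').
  pose hi i := Num.min (coord i q) (coord i q').
  pose W n i := bump (lo i) (hi i) n.+1.
  have tW n : tests p q (W n).
    move=> i; have [CW [a [b [pa bq h]]]] := @bump_test1 R (lo i) (hi i) n.
    split => //; exists a, b; split => //.
      by apply: le_lt_trans pa; rewrite le_max lexx.
    by apply: lt_le_trans bq _; rewrite ge_min lexx.
  have W01 n x : 0 <= tensor (W n) x <= 1.
    rewrite /tensor; apply/andP; split.
      by apply: prodr_ge0 => i _; exact: bump_ge0.
    by apply: prodr_ile1 => i _; rewrite bump_ge0 bump_le1.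
  have WI x : obox p q x ->
      tensor (W n) x @[n --> \oo] --> (\1_(obox p' q') x : R).
    move=> /oboxP Sx.
    rewrite (_ : \1_(obox p' q') x = \prod_(i < 3) (lo i < coord i x < hi i)%R%:R); last first.
      rewrite indicE; case: (boolP (x \in _)) => [|xN].
        rewrite inE => /oboxP h; rewrite big1 // => i _.
        have /andP[a b] := h i; have /andP[c d] := Sx i.
        by rewrite /lo /hi gt_max lt_min a b c d.
      have [i hi0] : exists i, ~~ (coord i p' < coord i x < coord i q').
        apply: contraNP xN => /forallNP h; rewrite inE; apply/oboxP => i.
        exact/negPn/negP/h.
      rewrite (bigD1 i) //= (_ : (_ < _ < _) = false) ?mul0r //.
      apply: contraNF hi0; rewrite /lo /hi gt_max lt_min.
      by move=> /andP[/andP[_ ->] /andP[_ ->]].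
    rewrite /tensor; under eq_fun do rewrite !big_ord_recl big_ord0.
    rewrite !big_ord_recl big_ord0.
    apply: cvgM; first exact: bump_cvg.
    apply: cvgM; first exact: bump_cvg.
    by apply: cvgM; [exact: bump_cvg|exact: cvg_cst].
  pose f n (x : M) := (g x * tensor (W n) x)%:E.
  have mf n : measurable_fun (obox p q : set M) (f n).
    apply/measurable_EFinP; apply: measurable_funM.
      exact/measurable_EFinP.
    apply: measurable_funTS; apply: continuous_measurable3 => x.
    by apply: (@Ck_continuous _ _ _ ev 0 setT) => //; apply: Ck_tensor => i; exact: (tW n i).1.
  have mI : measurable_fun (obox p q : set M)
      (fun x : M => (g x * \1_(obox p' q') x)%:E).
    apply/measurable_EFinP; apply: measurable_funM.
      exact/measurable_EFinP.
    by apply: measurable_funTS; apply: measurable_indic; exact: measurable_obox.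
  have aecv : {ae @volume R, forall x, obox p q x ->
      f ^~ x @ \oo --> (g x * \1_(obox p' q') x)%:E}.
    apply: aeW => x Sx; apply: cvg_EFin; first exact: nearW.
    by apply: cvgM; [exact: cvg_cst|exact: WI].
  have aebd : {ae @volume R, forall x n, obox p q x ->
      (`|f n x| <= (abse \o (EFin \o g)) x)%E}.
    apply: aeW => x n Sx; rewrite /f /= lee_fin normrM ler_piMr //.
    by have /andP[? ?] := W01 n x; rewrite ger0_norm.
  have [_ _ h] := @dominated_convergence _ _ _ (@volume R) _ mS f
    (fun x : M => (g x * \1_(obox p' q') x)%:E) (abse \o (EFin \o g)) mf mI
    aecv (integrable_abse ig) aebd.
  rewrite (_ : (fun n => _) = (fun=> 0%E)) in h; last first.
    by apply/funext => n; exact: g0.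
  have -> : (\int[volume]_(x in obox p q `&` obox p' q') (g x)%:E =
      \int[volume]_(x in obox p q) (g x * \1_(obox p' q') x)%:E)%E.
    rewrite integral_mkcondr; apply: eq_integral => x _; rewrite patchE indicE.
    by case: ifP => _; rewrite ?mulr1 ?mulr0.
  exact: (cvg_unique (@ereal_hausdorff R) h (cvg_cst _)).
have E0 := integral0_boxes ig sub0.
have := @integral_ae_eq _ _ _ (@volume R) _ mS (cst 0%E) (EFin \o g) ig
  (measurable_cst _).
case=> [E ES mE|N [mN N0 h]].
  rewrite integral0 -(E0 E mE); congr (integral _ _ _).
  by apply/esym/setIidPr.
exists N; split => //; apply: subset_trans h => x /= h1 h2; apply: h1 => Sx.
by have [] := h2 Sx.
Qed.

End tensor.

(** * Functions without weak gradient on a box *)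

Section primitives.
Context {R : realType}.
Local Notation leb := (@lebesgue_measure R).
Implicit Types (p q : R) (f : R -> R).

Definition primitive f (t : R) : R := \int[leb]_(s in `]-oo, t]) f s.

Section primitive_theory.
Variables (f : R -> R) (a b : R).
Hypothesis cf : continuous f.
Hypothesis f0 : forall t, ~~ (a <= t <= b) -> f t = 0.

Lemma interval_support_integrable : leb.-integrable setT (EFin \o f).
Proof.
have -> : EFin \o f = (EFin \o f) \_ `[a, b]%classic.
  apply/funext => x; rewrite patchE; case: ifPn => //=.
  by rewrite notin_setE /= in_itv /= => /negP h; rewrite f0.
have mab : measurable (`[a, b]%classic : set (measurableTypeR R)).
  exact: measurable_itv.
rewrite -(integrable_mkcond _ mab); apply: continuous_compact_integrable.
  exact: segment_compact.
exact: continuous_subspaceT.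
Qed.

Lemma is_derive_primitive (t : R) : is_derive t 1 (primitive f) (f t).
Proof.
have iu : leb.-integrable [set` Interval -oo%O (BRight (t + 1))] (EFin \o f).
  by apply: integrableS interval_support_integrable => //; exact: measurable_itv.
have t1 : t < t + 1 by rewrite ltrDl.
have [|d dE] := @continuous_FTC1 R f -oo%O t (t + 1) t1 iu _ (@cf t).
  by rewrite ltNyr.
by apply: DeriveDef; [exact: d|rewrite -derive1E; exact: dE].
Qed.

Lemma primitive_before t : t < a -> primitive f t = 0.
Proof.
move=> ta; rewrite /primitive /Rintegral integral0_eq // => s.
rewrite /= in_itv /= => st.
by rewrite f0 // negb_and -!ltNge (le_lt_trans st ta).
Qed.

Lemma primitive_after t : b <= t -> primitive f t = \int[leb]_s f s.
Proof.
move=> bt; rewrite /primitive Rintegral_mkcond; apply: eq_Rintegral => s _.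
rewrite patchE; case: ifPn => //; rewrite notin_setE /= in_itv /= => /negP.
rewrite -ltNge => ts; rewrite f0 // negb_and -!ltNge.
by rewrite (le_lt_trans bt ts) orbT.
Qed.

End primitive_theory.

(** A test function of zero integral has a compactly supported primitive, and the
    integral of [f - m * rho] vanishes for a suitable [m]. *)
Lemma test1_mod_derivatives p q : exists2 rho, test1 p q rho &
  forall f, test1 p q f -> exists m W, test1 p q W /\
    forall t : R, is_derive t 1 W (f t - m * rho t).
Proof.
have cont f : test1 p q f -> continuous f.
  by move=> [Cf _] t; exact: (Ck_continuous (Cf 0%N)).
have prim_test f m rho : test1 p q f -> test1 p q rho ->
    \int[leb]_s f s = m * \int[leb]_s rho s ->
    exists W, test1 p q W /\ forall t : R, is_derive t 1 W (f t - m * rho t).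
  move=> tf tr mE; have cf := cont _ tf; have cr := cont _ tr.
  have [Cf [a [b [pa bq f0]]]] := tf; have [Cr [a' [b' [pa' bq' r0]]]] := tr.
  pose W t := primitive f t - m * primitive rho t.
  have dW (t : R) : is_derive t 1 W (f t - m * rho t).
    have d1 := is_derive_primitive cf f0 t.
    have d2 := is_derive_primitive cr r0 t.
    apply: (is_derive_eq (is_deriveB d1 (is_deriveM (is_derive_cst m t 1) d2))).
    by rewrite /GRing.scale /= mulr0 addr0.
  exists W; split => //; split.
    have dW' (j : unit) (x : R) : [set: R] x -> is_derive x 1 W (f x - m * rho x).
      by [].
    move=> n; apply: (Ck1_family dW' _ n tt) => k _ _.
    by apply: CkB; [exact: Cf|apply: CkZ; exact: Cr].
  exists (Num.min a a'), (Num.max b b'); split.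
  - by rewrite lt_min pa pa'.
  - by rewrite gt_max bq bq'.
  move=> t; rewrite ge_min le_max negb_and !negb_or -!ltNge /W.
  move=> /orP[/andP[ta ta']|/andP[bt bt']].
    by rewrite (primitive_before f0) // (primitive_before r0) // mulr0 subrr.
  by rewrite (primitive_after f0) ?(ltW bt) // (primitive_after r0) ?(ltW bt') // mE subrr.
have [[rho [tr r0]]|h] := pselect (exists rho, test1 p q rho /\ \int[leb]_s rho s != 0).
  exists rho => // f tf; exists (\int[leb]_s f s / \int[leb]_s rho s).
  by apply: prim_test; rewrite ?divfK.
(* Otherwise every test function has zero integral, hence a primitive among the
   test functions, and zero is a suitable [rho]. *)
have t0 : test1 p q (fun=> 0).
  split; first by move=> n; exact: Ck_cst.
  by exists (p + 1), (q - 1); split => //; lra.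
exists (fun=> 0) => // f tf; exists 0; apply: prim_test => //.
rewrite mul0r; apply/eqP; apply: contra_notT h => fn0; by exists f.
Qed.

End primitives.

Section weak_gradient.
Context {R : realType}.
Local Notation V := (R * R * R)%type.
Local Notation M := (measurableTypeR R * measurableTypeR R * measurableTypeR R)%type.
Local Notation ev := (@unit_vector R).
Variables p q : V.

Definition gradient_free (h : V -> R) : Prop :=
  forall i phi, test_function (obox p q) phi ->
    (\int[volume]_(x in obox p q) (h x * partial [:: i] phi x)%:E = 0)%E.

Let mS : measurable (obox p q : set M). Proof. exact: measurable_obox. Qed.

Lemma bounded_mul_integrable (h f : M -> R) (N : R) :
  (@volume R).-integrable (obox p q) (EFin \o h) ->
  measurable_fun (obox p q : set M) f ->
  (forall x, `|f x| <= N) ->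
  (@volume R).-integrable (obox p q) (fun x => (h x * f x)%:E).
Proof.
move=> ih mf fN.
have mh : measurable_fun (obox p q : set M) h by exact/measurable_EFinP/measurable_int/ih.
apply: (@le_integrable _ _ _ (@volume R) _ mS _ (fun x => (N * h x)%:E)).
- by apply/measurable_EFinP; exact: measurable_funM.
- move=> x _; rewrite !abse_EFin lee_fin normrM mulrC [leRHS]normrM.
  by rewrite ler_wpM2r //; apply: le_trans (fN x) _; exact: ler_norm.
- by under eq_fun do rewrite EFinM; exact: integrableZl.
Qed.

Lemma tensor_bounded w : tests p q w -> exists N : R, forall x, `|tensor w x| <= N.
Proof.
move=> tw; have [a [b [_ h]]] := tests_support tw.
have cw : continuous (tensor w).
  move=> x; apply: (@Ck_continuous _ _ _ ev 0 setT) => //.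
  by apply: Ck_tensor => i; exact: (tw i).1.
have [N N0 wN] := compact_image_bounded (@compact_cbox _ a b) (continuous_subspaceT cw).
exists N => x; have [/wN//|/h ->] := pselect (cbox a b x); rewrite normr0; exact: ltW.
Qed.

Lemma tensor_measurable w : tests p q w ->
  measurable_fun (obox p q : set M) (tensor w : M -> R).
Proof.
move=> tw; apply: measurable_funTS; apply: continuous_measurable3 => x.
apply: (@Ck_continuous _ _ _ ev 0 setT) => //.
by apply: Ck_tensor => i; exact: (tw i).1.
Qed.

Definition pairing (h : V -> R) w : R :=
  fine (\int[volume]_(x in obox p q) (h x * tensor w x)%:E)%E.

Lemma pairingE h w : (@volume R).-integrable (obox p q) (EFin \o h) -> tests p q w ->
  (\int[volume]_(x in obox p q) (h x * tensor w x)%:E = (pairing h w)%:E)%E.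
Proof.
move=> ih tw; rewrite /pairing fineK //; have [N wN] := tensor_bounded tw.
by apply: integrable_fin_num => //; apply: bounded_mul_integrable ih (tensor_measurable tw) wN.
Qed.

Lemma pairing_upd w i rho m f W : tests p q w ->
  test1 (coord i p) (coord i q) rho -> test1 (coord i p) (coord i q) f ->
  test1 (coord i p) (coord i q) W ->
  (forall t : R, is_derive t 1 W (f t - m * rho t)) ->
  forall h, (@volume R).-integrable (obox p q) (EFin \o h) -> gradient_free h ->
  pairing h (upd w i f) = m * pairing h (upd w i rho).
Proof.
move=> tw tr tf tW dW h ih gh.
have h0 := gh i _ (tensor_test_function (tests_upd tw tW)).
rewrite (partial_tensor _ _ dW) in h0.
have E x : tensor (upd w i (fun t => f t - m * rho t)) x =
    tensor (upd w i f) x - m * tensor (upd w i rho) x.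
  by rewrite !tensor_upd mulrBl mulrA.
have int f' : test1 (coord i p) (coord i q) f' ->
    (@volume R).-integrable (obox p q) (fun x => (h x * tensor (upd w i f') x)%:E).
  move=> tf'; have tu := tests_upd tw tf'; have [N wN] := tensor_bounded tu.
  exact: bounded_mul_integrable ih (tensor_measurable tu) wN.
have {}h0 : (\int[volume]_(x in obox p q) ((h x * tensor (upd w i f) x)%:E -
    m%:E * (h x * tensor (upd w i rho) x)%:E) = 0)%E.
  rewrite -h0; apply: eq_integral => x _.
  by rewrite E -EFinM -EFinB; congr EFin; ring.
move: h0.
rewrite integralB //; [|exact: int|by apply: integrableZl => //; exact: int].
rewrite integralZl //; last exact: int.
rewrite !pairingE //; try exact: tests_upd.
by rewrite -EFinM -EFinB => -[] /eqP; rewrite subr_eq0 => /eqP.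
Qed.

(** Replacing the factors of a tensor one after the other by multiples of [rho].
    The coefficient [m] does not depend on [h], so that two functions without
    weak gradient can be compared. *)
Lemma pairing_reduction : exists2 rho, tests p q rho &
  forall w, tests p q w -> exists m, forall h,
    (@volume R).-integrable (obox p q) (EFin \o h) -> gradient_free h ->
    pairing h w = m * pairing h rho.
Proof.
have /choice[rho hrho] : forall i : 'I_3, exists rho,
   test1 (coord i p) (coord i q) rho /\
   forall f, test1 (coord i p) (coord i q) f -> exists m W,
     test1 (coord i p) (coord i q) W /\
     forall t : R, is_derive t 1 W (f t - m * rho t).
  by move=> i; have [r tr hr] := test1_mod_derivatives (coord i p) (coord i q); exists r.
have trho : tests p q rho by move=> i; exact: (hrho i).1.
exists rho => // w tw.
have step v i : tests p q v -> exists m, forall h,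
    (@volume R).-integrable (obox p q) (EFin \o h) -> gradient_free h ->
    pairing h v = m * pairing h (upd v i (rho i)).
  move=> tv; have [m [W [tW dW]]] := (hrho i).2 _ (tv i).
  exists m => h ih gh; rewrite -(pairing_upd tv (trho i) (tv i) tW dW ih gh).
  by congr (pairing h); apply/funext => j; rewrite /upd; case: eqP => [->|].
pose i0 := @Ordinal 3 0 isT; pose i1 := @Ordinal 3 1 isT; pose i2 := @Ordinal 3 2 isT.
have [m0 h0] := step w i0 tw.
have t0 := tests_upd tw (trho i0).
have [m1 h1] := step _ i1 t0.
have t1 := tests_upd t0 (trho i1).
have [m2 h2] := step _ i2 t1.
exists (m0 * m1 * m2) => h ih gh.
rewrite (h0 h ih gh) (h1 h ih gh) (h2 h ih gh) !mulrA; congr (_ * pairing h _).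
by apply/funext => -[[|[|[|//]]] ?]; rewrite /upd -!val_eqE /=; congr rho; exact: val_inj.
Qed.

Lemma volume_obox_gt0 : obox p q !=set0 -> (0 < volume (obox p q : set M))%E.
Proof.
move=> [x [h1 h2 h3]].
have l0 (a b t : R) : a < t < b -> (0 < lebesgue_measure `]a, b[%classic)%E.
  move=> /andP[a_t t_b]; rewrite lebesgue_measure_itv /= lte_fin (lt_trans a_t t_b).
  by rewrite -EFinB lte_fin subr_gt0 (lt_trans a_t t_b).
rewrite oboxE /volume /= product_measure1E //; last first.
  by apply: measurableX; exact: measurable_itv.
apply: mule_gt0; last exact: l0 h3.
set A := (X in (_ < _ X)%E).
suff : (0 < (lebesgue_measure \x lebesgue_measure) A)%E by [].
rewrite product_measure1E; [|exact: measurable_itv|exact: measurable_itv].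
by apply: mule_gt0; [exact: l0 h1|exact: l0 h2].
Qed.

Lemma volume_obox_lty : (volume (obox p q : set M) < +oo)%E.
Proof.
apply: le_lt_trans (volume_cbox p q); apply: le_measure; rewrite ?inE //.
  exact: measurable_cbox.
exact: obox_cbox.
Qed.

Lemma gradient_free_cst (c : R) : gradient_free (fun=> c).
Proof.
move=> i phi [sphi [K [cK KS phi0]]].
have dphi x := (sphi [::]).2 i x.
have C1 : continuous (partial [:: i] phi) := (sphi [:: i]).1.
have K0 x : ~ K x -> partial [:: i] phi x = 0.
  exact: (derive_off_support _ (compact_closed (@norm_hausdorff _ _) cK) phi0).
have i0 : (\int[volume]_x (partial [:: i] phi x)%:E = 0)%E.
  by apply: (@integral_partial0 _ i phi _ K) => // x; exact: derivableP.
have ip : (@volume R).-integrable setT (fun x => (partial [:: i] phi x)%:E).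
  exact: compact_support_integrable C1 cK K0.
have -> : (\int[volume]_(x in obox p q) (c * partial [:: i] phi x)%:E =
   \int[volume]_x (c%:E * (partial [:: i] phi x)%:E))%E.
  rewrite integral_mkcond; apply: eq_integral => x _; rewrite patchE EFinM.
  case: ifPn => //; rewrite notin_setE => Sx; rewrite K0 ?mule0 //.
  by move/KS.
by rewrite integralZl // i0 mule0.
Qed.

(** Take for [c] the ratio of the pairings of [h] and of [1] with [rho]: then
    [h - c] is orthogonal to all tensors. The denominator is nonzero on a nonempty
    box, since otherwise [1] itself would be orthogonal to all tensors. *)
Lemma gradient_free_ae_cst (h : V -> R) :
  (@volume R).-integrable (obox p q) (EFin \o h) -> gradient_free h ->
  exists c : R, {ae @volume R, forall x, obox p q x -> h x = c}.
Proof.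
move=> ih gh; have [rho trho red] := pairing_reduction.
have i1 (c : R) : (@volume R).-integrable (obox p q) (EFin \o (fun=> c)).
  apply: (@bounded_integrable _ _ (fun=> c) `|c|) => //; exact: volume_obox_lty.
have [z|z] := eqVneq (pairing (fun=> 1) rho) 0.
  have := @integral_obox_tensors R p q (fun=> 1) (i1 1) _.
  case=> [w tw|N [mN N0 hN]].
    have [m hm] := red w tw.
    by rewrite pairingE // hm ?z ?mulr0 //; exact: gradient_free_cst.
  exists 0; exists N; split => // x /= hx; apply: hN => /= h1.
  by apply: hx => Sx; have /eqP := h1 Sx; rewrite oner_eq0.
pose c := pairing h rho / pairing (fun=> 1) rho.
exists c.
have ihc : (@volume R).-integrable (obox p q) (EFin \o (fun x => h x - c)).
  rewrite (_ : EFin \o _ = (EFin \o h) \- (EFin \o (fun=> c)))%E; last first.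
    by apply/funext => x /=; rewrite EFinB.
  exact: integrableB.
have := integral_obox_tensors ihc.
case=> [w tw|N [mN N0 hN]]; last first.
  exists N; split => // x /= hx; apply: hN => /= h1; apply: hx => Sx.
  by apply/eqP; rewrite -subr_eq0 h1.
have [m hm] := red w tw; have [B wB] := tensor_bounded tw.
have int g : (@volume R).-integrable (obox p q) (EFin \o g) ->
    (@volume R).-integrable (obox p q) (fun x => (g x * tensor w x)%:E).
  by move=> ig; exact: bounded_mul_integrable ig (tensor_measurable tw) wB.
transitivity (\int[volume]_(x in obox p q)
   ((h x * tensor w x)%:E - c%:E * (1 * tensor w x)%:E))%E.
  by apply: eq_integral => x _; rewrite -EFinM -EFinB mul1r mulrBl.
rewrite integralB //; [|exact: int|by apply: integrableZl => //; exact: (int (fun=> 1))].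
rewrite integralZl //; last exact: (int (fun=> 1)).
rewrite (pairingE ih tw) (pairingE (i1 1) tw) hm // hm //; last exact: gradient_free_cst.
by rewrite -EFinM -EFinB; congr EFin; rewrite /c; field.
Qed.

End weak_gradient.

(** * From boxes to open sets, and connectedness of the annulus *)

(** The iterated product in the type of [volume] hides this instance from
    inference. *)
#[global] Instance volume_ae_filter {R : realType} :
  Filter (nbhs (almost_everywhere (@volume R))).
Proof. exact: ae_filter_ringOfSetsType. Qed.

Section from_boxes_to_open_sets.
Context {R : realType}.
Local Notation V := (R * R * R)%type.
Local Notation M := (measurableTypeR R * measurableTypeR R * measurableTypeR R)%type.
Local Notation ev := (@unit_vector R).
Variable O : set V.
Hypothesis oO : open O.
Let mO : measurable (O : set M). Proof. exact: open_measurable3. Qed.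

(** Countably many rational boxes cover [O]. *)
Lemma ae_box_cover (P : V -> Prop) :
  (forall p q, cbox p q `<=` O -> {ae @volume R, forall x, obox p q x -> P x}) ->
  {ae @volume R, forall x, O x -> P x}.
Proof.
move=> h.
pose B (k : rat * rat * rat * (rat * rat * rat)) (x : V) :=
  cbox (rat_point k.1) (rat_point k.2) `<=` O ->
  obox (rat_point k.1) (rat_point k.2) x -> P x.
have : {ae @volume R, forall x (n : nat), if unpickle n is Some k then B k x else True}.
  apply/ae_foralln => n; case: unpickle => [k|]; last exact: aeW.
  have [kO|kO] := pselect (cbox (rat_point k.1) (rat_point k.2) `<=` O).
    by apply: filterS (h _ _ kO) => x hx _.
  by apply: aeW => x /kO.
apply: filterS => x Bx Ox; have [p [q [xpq pqO]]] := rational_box oO Ox.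
by have := Bx (pickle (p, q)); rewrite pickleK => /(_ pqO xpq).
Qed.

Lemma test_function_sub (A B : set V) w : A `<=` B ->
  test_function A w -> test_function B w.
Proof.
move=> AB [sw [K [cK KA w0]]]; split => //; exists K; split => //.
exact: subset_trans AB.
Qed.

Lemma obox_sub p q : cbox p q `<=` O -> obox p q `<=` O.
Proof. by move=> h; apply: subset_trans h; exact: obox_cbox. Qed.

Lemma L2_obox (g : V -> R) p q : L2 O g -> cbox p q `<=` O -> L2 (obox p q) g.
Proof.
move=> Lg /obox_sub SO.
have mS : measurable (obox p q : set M) by exact: measurable_obox.
apply: L2_of_integrable => //; first exact: measurable_funS (L2_measurable mO Lg).
exact: integrableS (L2_sqr_integrable mO Lg).
Qed.

Lemma L2_obox_integrable (g : V -> R) p q : L2 O g -> cbox p q `<=` O ->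
  (@volume R).-integrable (obox p q) (EFin \o g).
Proof.
move=> Lg pqO; have mS : measurable (obox p q : set M) by exact: measurable_obox.
have LS := L2_obox Lg pqO.
have L1 : L2 (obox p q) (fun=> 1).
  apply: (@L2_bounded _ _ mS _ 1) => //; first exact: volume_obox_lty.
  by move=> x _; rewrite normr1.
have := L2_mul_integrable mS LS L1.
by under eq_fun do rewrite mulr1.
Qed.

Lemma L2_inner_obox (g w : V -> R) p q : cbox p q `<=` O ->
  (forall x, ~ obox p q x -> w x = 0) ->
  L2_inner O g w = fine (\int[volume]_(x in obox p q) (g x * w x)%:E)%E.
Proof.
move=> pqO w0; rewrite /L2_inner /Rintegral; congr fine.
rewrite integral_mkcond [RHS]integral_mkcond; apply: eq_integral => x _.
rewrite !patchE; have [Sx|Sx] := pselect (obox p q x).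
  by rewrite (mem_set Sx) (mem_set (obox_sub pqO Sx)).
by rewrite (w0 _ Sx) mulr0; do 2 case: ifP.
Qed.

(** The fundamental lemma of the calculus of variations *)
Lemma ae_eq0_of_tests (g : V -> R) : L2 O g ->
  (forall w, test_function O w -> L2_inner O g w = 0) -> ae_on O g (cst 0).
Proof.
move=> Lg g0; apply: ae_box_cover => p q pqO.
have ig := L2_obox_integrable Lg pqO.
apply: integral_obox_tensors => // w tw.
have tf := tensor_test_function tw.
have [N wN] := tensor_bounded tw.
have int := bounded_mul_integrable ig (tensor_measurable tw) wN.
have := g0 _ (test_function_sub (obox_sub pqO) tf).
rewrite (L2_inner_obox _ pqO) => [E|x Sx]; last first.
  by have [_ [K [_ KS w0]]] := tf; apply: w0 => /KS.
have fin : (\int[volume]_(x in obox p q) (g x * tensor w x)%:E)%E \is a fin_num.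
  by apply: integrable_fin_num => //; exact: measurable_obox.
by rewrite -(fineK fin) E.
Qed.

Lemma weak_partial_unique s (u g g' : V -> R) : L2 O g -> L2 O g' ->
  weak_partial O s u g -> weak_partial O s u g' ->
  (forall w, test_function O w -> L2 O w) -> ae_on O g g'.
Proof.
move=> Lg Lg' hg hg' Lt.
have := @ae_eq0_of_tests (g \- g') (L2_sub Lg Lg').
case=> [w tw|N [mN N0 h]].
  rewrite L2_innerBl //; try exact: Lt.
  have := hg w tw; rewrite (hg' w tw) => /mulfI E.
  by rewrite E ?subrr // signr_eq0.
exists N; split => //; apply: subset_trans h => x /= h1 h2; apply: h1 => Ox.
by apply/eqP; rewrite -subr_eq0; apply/eqP; exact: h2.
Qed.

Lemma ae_cst_unique (h : V -> R) (p q : V) (c c' : R) : obox p q !=set0 ->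
  {ae @volume R, forall x, obox p q x -> h x = c} ->
  {ae @volume R, forall x, obox p q x -> h x = c'} -> c = c'.
Proof.
move=> S0 hc hc'; apply: contrapT => cc'; have := volume_obox_gt0 S0.
have [N [mN N0 hN]] : {ae @volume R, forall x, obox p q x -> False}.
  by apply: filterS2 hc hc' => x h1 h2 Sx; apply: cc'; rewrite -(h1 Sx) -(h2 Sx).
rewrite ltNge -N0 => /negP; apply; apply: le_measure; rewrite ?inE //.
  exact: measurable_obox.
by move=> x Sx; apply: hN => /(_ Sx).
Qed.

Lemma obox_setI p q p' q' (x : V) : obox p q x -> obox p' q' x ->
  exists r s, obox r s x /\ obox r s `<=` obox p q `&` obox p' q'.
Proof.
move=> /oboxP h /oboxP h'.
exists (point_of (fun i => Num.max (coord i p) (coord i p'))).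
exists (point_of (fun i => Num.min (coord i q) (coord i q'))); split.
  apply/oboxP => i; rewrite !coord_point_of gt_max lt_min.
  by have /andP[-> ->] := h i; have /andP[-> ->] := h' i.
move=> y /oboxP hy; split; apply/oboxP => i; have := hy i;
  rewrite !coord_point_of gt_max lt_min.
  by move=> /andP[/andP[-> _] /andP[-> _]].
by move=> /andP[/andP[_ ->] /andP[_ ->]].
Qed.

Definition locally_constant (c : V -> R) : Prop :=
  forall x, O x -> \forall y \near x, c y = c x.

(** The constants on overlapping boxes agree, so they form a locally constant
    function on [O]. *)
Lemma gradient_free_cst_open (h : V -> R) :
  (forall p q, cbox p q `<=` O -> (@volume R).-integrable (obox p q) (EFin \o h)) ->
  (forall c x y, locally_constant c -> O x -> O y -> c x = c y) ->
  (forall i phi, test_function O phi -> L2_inner O h (partial [:: i] phi) = 0) ->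
  exists c : R, ae_on O h (fun=> c).
Proof.
move=> Lh conn gh.
have box p q : cbox p q `<=` O ->
    exists c : R, {ae @volume R, forall x, obox p q x -> h x = c}.
  move=> pqO; have ih := Lh _ _ pqO.
  apply: gradient_free_ae_cst => // i phi tphi.
  have [sphi [K [cK KS phi0]]] := tphi.
  have cl : closed K by exact: compact_closed.
  have := gh i phi (test_function_sub (obox_sub pqO) tphi).
  have out x : ~ obox p q x -> partial [:: i] phi x = 0.
    by move=> Sx; apply: (derive_off_support _ cl phi0) => /KS.
  rewrite (L2_inner_obox _ pqO out) => E.
  have [N N0 bN] := @compact_image_bounded R K _ cK (continuous_subspaceT (sphi [:: i]).1).
  have int : (@volume R).-integrable (obox p q) (fun x => (h x * partial [:: i] phi x)%:E).
    apply: (@bounded_mul_integrable _ _ _ _ _ N) => //.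
      by apply: measurable_funTS; apply: continuous_measurable3; exact: (sphi [:: i]).1.
    move=> x; have [/bN//|Kx] := pselect (K x).
    by rewrite /= (derive_off_support _ cl phi0 Kx) normr0 ltW.
  have fin : (\int[volume]_(x in obox p q) (h x * partial [:: i] phi x)%:E)%E \is a fin_num.
    by apply: integrable_fin_num => //; exact: measurable_obox.
  by rewrite -(fineK fin) E.
have [[x0 Ox0]|O0] := pselect (O !=set0); last first.
  exists 0; apply: aeW => x Ox; exfalso; apply: O0; by exists x.
have pickbox x : exists pqc : V * V * R, O x ->
    [/\ obox pqc.1.1 pqc.1.2 x, cbox pqc.1.1 pqc.1.2 `<=` O &
       {ae @volume R, forall y, obox pqc.1.1 pqc.1.2 y -> h y = pqc.2}].
  have [Ox|Ox] := pselect (O x); last by exists (x, x, 0).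
  have [p [q [xpq pqO]]] := rational_box oO Ox.
  by have [c hc] := box _ _ pqO; exists (rat_point p, rat_point q, c).
have [f hf] := choice pickbox; pose c x := (f x).2.
have cE p q x k : O x -> obox p q x ->
    {ae @volume R, forall y, obox p q y -> h y = k} -> c x = k.
  move=> Ox Sx hk; have [Bx _ hc] := hf x Ox.
  have [r [s [rsx rs]]] := obox_setI Sx Bx.
  apply: (@ae_cst_unique h r s) => //; first by exists x.
    by apply: filterS hc => y hy /rs[_]; exact: hy.
  by apply: filterS hk => y hy /rs[+ _]; exact: hy.
have lc : locally_constant c.
  move=> x Ox; have [Bx BO hc] := hf x Ox.
  near=> y; have By : obox (f x).1.1 (f x).1.2 y.
    by near: y; apply: open_nbhs_nbhs; split => //; exact: open_obox.
  exact: (cE _ _ y _ (BO _ (obox_cbox By)) By hc).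
exists (c x0); apply: ae_box_cover => p q pqO; have [k hk] := box _ _ pqO.
apply: filterS (hk) => x hx Sx; have Ox : O x := pqO _ (obox_cbox Sx).
by rewrite (hx Sx) -(cE p q x k Ox Sx hk); exact: conn.
Unshelve. all: by end_near. Qed.

End from_boxes_to_open_sets.

Section annulus_connected.
Context {R : realType}.
Local Notation V := (R * R * R)%type.
Local Notation ev := (@unit_vector R).
Implicit Types (x y z : V).

Lemma enorm_ge0 x : 0 <= enorm x. Proof. exact: sqrtr_ge0. Qed.

Lemma enormZ (c : R) x : enorm (c *: x) = `|c| * enorm x.
Proof.
rewrite -[`|c|](@sqrtr_sqr R) -sqrtrM ?sqr_ge0 // /enorm; congr Num.sqrt.
by case: x => [[a b] d] /=; rewrite /GRing.scale /= /GRing.scale /=; ring.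
Qed.

Lemma enorm_gt0P x : 0 < enorm x <-> exists j, coord j x != 0.
Proof.
split=> [x0|[j xj]].
  apply: contrapT => /forallNP h; move: x0; rewrite lt0r -sqrf_eq0 -sum_coord_sqr.
  by rewrite big1 ?eqxx // => j _; have /negP/negPn/eqP -> := h j; rewrite expr0n.
rewrite lt0r enorm_ge0 andbT -sqrf_eq0 -sum_coord_sqr gt_eqF //.
rewrite (bigD1 j) //= ltr_pwDl //; first by rewrite exprn_even_gt0.
by apply: sumr_ge0 => i _; exact: sqr_ge0.
Qed.

Lemma coordD j x y : coord j (x + y) = coord j x + coord j y.
Proof. by case: j => [[|[|[|//]]] ?]. Qed.

Lemma coordZ j (c : R) x : coord j (c *: x) = c * coord j x.
Proof. by case: j => [[|[|[|//]]] ?]. Qed.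

Lemma open_annulus (A : R) : open (annulus A : set V).
Proof.
have -> : annulus A = @enorm R @^-1` `]A / 2, (1 + A / 2)[%classic.
  by apply/seteqP; split=> x /=; rewrite /annulus /= in_itv.
exact: ((continuousP (@enorm R)).1 (@enorm_continuous R)) (interval_open _ _).
Qed.

Lemma locally_constant_path (O : set V) (c : V -> R) (gam : R -> V) :
  locally_constant O c ->
  (forall t : R, 0 <= t <= 1 -> {for t, continuous gam}) ->
  (forall t : R, 0 <= t <= 1 -> O (gam t)) -> c (gam 0) = c (gam 1).
Proof.
move=> lc cg gO; pose d t := c (gam t).
have ld (t : R) : 0 <= t <= 1 -> \forall s \near t, d s = d t.
  by move=> t01; exact: cg t01 _ (lc _ (gO t t01)).
pose B := `[0, 1]%classic `&` [set t | d t = d 0].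
have z01 : 0 <= (0 : R) <= 1 by rewrite lexx ler01.
have BE : B = `[0, 1]%classic.
  apply: (@segment_connected R 0 1) => //.
  - by exists 0; split => //=; rewrite in_itv.
  - exists (interior [set t | d t = d 0]); first exact: open_interior.
    apply/seteqP; split=> t [/=]; rewrite in_itv /= => t01 dt; split => //.
      by apply: filterS (ld t t01) => s /= ->.
    exact: nbhs_singleton dt.
  - exists (~` interior [set t | d t <> d 0]); first exact/open_closedC/open_interior.
    apply/seteqP; split=> t [/=]; rewrite in_itv /= => t01 dt; split => //.
      by move=> /nbhs_singleton /= /(_ dt).
    apply: contrapT => dt0; apply: dt.
    by apply: filterS (ld t t01) => s /= ->.
have : B 1 by rewrite BE /= in_itv /= ler01 lexx.
by case.
Qed.

(** The segment from [x] to [y], rescaled so that its norm interpolates between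
    the norms of [x] and [y], stays in the annulus. *)
Lemma locally_constant_segment (A : R) (c : V -> R) x y : 0 < A ->
  locally_constant (annulus A) c -> annulus A x -> annulus A y ->
  (forall t : R, 0 <= t <= 1 -> 0 < enorm ((1 - t) *: x + t *: y)) -> c x = c y.
Proof.
move=> A0 lc /andP[x1 x2] /andP[y1 y2] z0.
have A20 : 0 < A / 2 by rewrite divr_gt0.
pose z (t : R) : V := (1 - t) *: x + t *: y.
pose rho (t : R) : R := (1 - t) * enorm x + t * enorm y.
pose gam (t : R) : V := (rho t / enorm (z t)) *: z t.
have g0 : gam 0 = x.
  rewrite /gam /z /rho subr0 mul1r mul0r addr0 scale1r scale0r addr0 divff ?scale1r //.
  by rewrite gt_eqF // (lt_trans A20).
have g1 : gam 1 = y.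
  rewrite /gam /z /rho subrr mul1r mul0r add0r scale1r scale0r add0r divff ?scale1r //.
  by rewrite gt_eqF // (lt_trans A20).
have ci (t : R) : {for t, continuous (fun t : R => t)} by exact: cvg_id.
have c1i (t : R) : {for t, continuous (fun t : R => 1 - t)}.
  by apply: continuousB; [exact: cst_continuous|exact: ci].
rewrite -g0 -[in RHS]g1; apply: (locally_constant_path lc) => t t01.
  have cz : {for t, continuous z}.
    by apply: continuousD; apply: continuousZr_tmp; [exact: c1i|exact: ci].
  have cr : {for t, continuous rho}.
    apply: continuousD; apply: continuousM; try exact: cst_continuous.
      exact: c1i.
    exact: ci.
  have ce : {for t, continuous (fun t => (enorm (z t))^-1)}.
    apply: continuousV; first by rewrite gt_eqF // z0.
    by apply: continuous_comp; [exact: cz|exact: enorm_continuous].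
  by apply: continuousZ => //; exact: continuousM.
have r0 : A / 2 < rho t < 1 + A / 2.
  case/andP: t01 => t0; rewrite le_eqVlt /rho => /predU1P[->|t1].
    by rewrite subrr mul0r add0r mul1r y1 y2.
  have t1' : 0 < 1 - t by rewrite subr_gt0.
  have := mulr_gt0 t1' (_ : 0 < enorm x - A / 2); rewrite subr_gt0 => /(_ x1) h1.
  have := mulr_gt0 t1' (_ : 0 < 1 + A / 2 - enorm x); rewrite subr_gt0 => /(_ x2) h2.
  have := mulr_ge0 t0 (_ : 0 <= enorm y - A / 2).
  rewrite subr_ge0 => /(_ (ltW y1)) h3.
  have := mulr_ge0 t0 (_ : 0 <= 1 + A / 2 - enorm y).
  rewrite subr_ge0 => /(_ (ltW y2)) h4.
  by apply/andP; split; lra.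
have rp : 0 < rho t by case/andP: r0 => r0 _; exact: lt_trans r0.
rewrite /annulus /= enormZ ger0_norm; last by rewrite divr_ge0 ?enorm_ge0 // ltW.
by rewrite divfK // gt_eqF // z0.
Qed.

(** Any two points are joined through a point of a coordinate axis to which
    neither of them is parallel. *)
Lemma annulus_locally_constant (A : R) (c : V -> R) x y : 0 < A ->
  locally_constant (annulus A) c -> annulus A x -> annulus A y -> c x = c y.
Proof.
move=> A0 lc Ox Oy.
have A20 : 0 < A / 2 by rewrite divr_gt0.
have pos v : annulus A v -> 0 < enorm v by case/andP=> v1 _; exact: lt_trans v1.
have [j xj] := (enorm_gt0P x).1 (pos _ Ox); have [k yk] := (enorm_gt0P y).1 (pos _ Oy).
have [i ij ik] : exists2 i : 'I_3, i != j & i != k.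
  have : (0 < #|~: [set j; k]|)%N.
    by rewrite cardsCs finset.setCK card_ord subn_gt0 cards2; case: (j != k).
  by move=> /card_gt0P[i]; rewrite !inE negb_or => /andP[? ?]; exists i.
pose m : V := enorm x *: ev i.
have mE l : coord l m = enorm x * (i == l)%:R.
  have := coord_line l i (enorm x) 0; rewrite addr0 => ->.
  by rewrite (_ : coord l 0 = 0) ?addr0 //; case: l => [[|[|[|//]]] ?].
have m0 v l (t : R) : i != l -> coord l v != 0 -> 0 <= t <= 1 ->
    0 < enorm ((1 - t) *: v + t *: m).
  move=> il vl _; apply/enorm_gt0P; have [->|t1] := eqVneq t 1.
    exists i; rewrite subrr scale0r add0r scale1r mE eqxx mulr1 gt_eqF //; exact: pos.
  exists l; rewrite coordD (coordZ l (1 - t)) (coordZ l t) mE (negbTE il) !mulr0 addr0.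
  by rewrite mulf_neq0 // subr_eq0 eq_sym.
have Om : annulus A m.
  have ev1 : enorm (ev i) = 1.
    apply/eqP; rewrite -sqrp_eq1 ?enorm_ge0 // sqr_enormE /unit_vector /=.
    by case: i {ij ik m mE m0} => [[|[|[|//]]] ?] /=; apply/eqP; ring.
  by rewrite /annulus /= enormZ ev1 mulr1 ger0_norm ?enorm_ge0.
rewrite (locally_constant_segment A0 lc Ox Om); last by move=> t; exact: m0 xj.
by rewrite (locally_constant_segment A0 lc Oy Om) //; move=> t; exact: m0 yk.
Qed.

End annulus_connected.

(** * Integration by parts against test functions *)

Section test_functions.
Context {R : realType}.
Local Notation V := (R * R * R)%type.
Local Notation M := (measurableTypeR R * measurableTypeR R * measurableTypeR R)%type.
Local Notation ev := (@unit_vector R).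
Implicit Types (x : V) (f w : V -> R) (i : 'I_3).

Section open_domain.
Variable O : set V.
Hypothesis oO : open O.
Hypothesis vO : (volume (O : set M) < +oo)%E.
Let mO : measurable (O : set M). Proof. exact: open_measurable3. Qed.

Lemma Ck_measurable f : Ck ev 0 O f -> measurable_fun (O : set M) (f : M -> R).
Proof.
move=> Cf; apply: (measurability _ (RGenOpens.measurableE R)) => //.
move=> _ [_ [a [b ->] <-]]; apply: open_measurable3.
rewrite openE => x [Ox /= fx].
have fI : \forall y \near x, `]a, b[%classic (f y).
  by apply: (Ck_continuous Cf Ox); apply: open_nbhs_nbhs; split => //; exact: interval_open.
by apply: filterI => //; apply: open_nbhs_nbhs.
Qed.

Lemma test_Ck n w : test_function O w -> Ck ev n setT w.
Proof. by move=> [/smooth_Ck Cw _]. Qed.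

Lemma test_is_derive w i x : test_function O w ->
  is_derive x (ev i) w (partial [:: i] w x).
Proof. by move=> [sw _]; apply: derivableP; exact: (sw [::]).2. Qed.

Lemma test_partial s w : test_function O w -> test_function O (partial s w).
Proof.
move=> [sw [K [cK KO w0]]]; split.
  move=> s'; rewrite (_ : partial s' (partial s w) = partial (s' ++ s) w).
    exact: sw.
  by rewrite /partial foldr_cat.
exists K; split => //; elim: s => [//|i s IH] x Kx /=.
exact: (derive_off_support _ (compact_closed (@norm_hausdorff _ _) cK) IH Kx).
Qed.

Lemma test_sub w w' : test_function O w -> test_function O w' ->
  test_function O (w \- w').
Proof.
move=> tw tw'; split.
  by apply/smooth_Ck => n; apply: CkB; exact: test_Ck.
have [_ [K [cK KO w0]]] := tw; have [_ [K' [cK' KO' w0']]] := tw'.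
exists (K `|` K'); split.
- exact: compactU.
- by move=> x [/KO|/KO'].
by move=> x /not_orP[/w0 /= -> /w0' ->]; rewrite subrr.
Qed.

Lemma partial_sub i w w' : test_function O w -> test_function O w' ->
  partial [:: i] (w \- w') = partial [:: i] w \- partial [:: i] w'.
Proof.
move=> tw tw'; apply/funext => x.
have [_] := is_deriveB (test_is_derive i x tw) (test_is_derive i x tw').
by [].
Qed.

(** Multiplying by a test function makes singularities at the boundary of the
    domain harmless. *)
Lemma Ck_mul_test n f w : Ck ev n O f -> test_function O w -> Ck ev n setT (f \* w).
Proof.
move=> Cf tw; have [_ [K [cK KO w0]]] := tw.
have cl : closed K by exact: (compact_closed (@norm_hausdorff _ _) cK).
apply: (Ck_glue oO cl KO) => [x Kx|]; first by rewrite /= w0 // mulr0.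
by apply: CkM => //; apply: Ck_sub (test_Ck n tw).
Qed.

Lemma L2_mul_test f w : Ck ev 0 O f -> test_function O w -> L2 O (f \* w).
Proof.
move=> Cf tw; have [_ [K [cK KO w0]]] := tw.
have cfw : continuous (f \* w).
  by move=> x; exact: (Ck_continuous (Ck_mul_test Cf tw)).
have [N N0 bN] := compact_image_bounded cK (continuous_subspaceT cfw).
apply: (L2_bounded mO (N := N) vO).
  by apply: measurable_funTS; exact: continuous_measurable3.
move=> x _; have [/bN//|Kx] := pselect (K x).
by rewrite /= w0 // mulr0 normr0 ltW.
Qed.

Lemma L2_cst (c : R) : L2 O (fun=> c).
Proof. by apply: (L2_bounded mO (N := `|c|) vO) => //; exact: measurable_cst. Qed.

Lemma L2_test w : test_function O w -> L2 O w.
Proof.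
move=> tw; have := L2_mul_test (Ck_cst ev 0 O 1) tw.
by congr (L2 O _); apply/funext => x /=; rewrite mul1r.
Qed.

Lemma L2_inner1 f : L2_inner O f (fun=> 1) = \int[volume]_(x in O) f x.
Proof. by apply: eq_Rintegral => x _; rewrite mulr1. Qed.

(** The product [f * w], extended by zero, has compact support and continuous
    derivatives. *)
Lemma integration_by_parts_test i f f' w : Ck ev 1 O f ->
  (forall x, O x -> is_derive x (ev i) f (f' x)) -> test_function O w ->
  L2_inner O f (partial [:: i] w) = - L2_inner O f' w.
Proof.
move=> Cf df tw; have [_ [K [cK KO w0]]] := tw.
have cl : closed K by exact: (compact_closed (@norm_hausdorff _ _) cK).
have tpw := test_partial [:: i] tw.
have [g Cg dg] := (Ck_mul_test Cf tw).2 i.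
have [f1 Cf1 df1] := Cf.2 i.
have f1E x : O x -> f1 x = f' x.
  by move=> Ox; have [_ <-] := df1 x Ox; have [_ <-] := df x Ox.
have gE x : O x -> g x = f x * partial [:: i] w x + f' x * w x.
  move=> Ox; have [_ <-] := dg x I.
  have [_ ->] := is_deriveM (df x Ox) (test_is_derive i x tw).
  by rewrite /GRing.scale /= [w x * _]mulrC.
have fw0 x : ~ K x -> (f \* w) x = 0 by move=> Kx; rewrite /= w0 // mulr0.
have g0 x : ~ K x -> g x = 0.
  by move=> Kx; have [_ <-] := dg x I; exact: (derive_off_support _ cl fw0 Kx).
have cg : continuous g by move=> x; exact: (Ck_continuous (Cg : Ck ev 0 setT g) I).
have ig := integral_partial0 cK (fun x => dg x I) cg fw0 g0.
have L1 := L2_mul_test (CkS Cf) tpw; have L2' := L2_mul_test Cf1 tw.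
have : L2_inner O (f \* partial [:: i] w) (fun=> 1) + L2_inner O (f1 \* w) (fun=> 1) = 0.
  rewrite -L2_innerDl //; last exact: L2_cst.
  rewrite L2_inner1 /Rintegral -[RHS](congr1 fine ig) integral_mkcond.
  congr fine; apply: eq_integral => x _; rewrite patchE.
  case: ifPn => [|]; first by rewrite inE => Ox /=; rewrite f1E // gE.
  by rewrite notin_setE => Ox; rewrite g0 // => /KO.
rewrite !L2_inner1 => /eqP; rewrite addr_eq0 => /eqP E.
rewrite [LHS]E; congr (- _); apply: eq_Rintegral => x; rewrite inE => Ox /=.
by rewrite f1E.
Qed.

End open_domain.

End test_functions.

Section annulus_geometry.
Context {R : realType}.
Local Notation V := (R * R * R)%type.
Local Notation M := (measurableTypeR R * measurableTypeR R * measurableTypeR R)%type.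
Local Notation ev := (@unit_vector R).
Variable A : R.
Hypothesis A0 : 0 < A.

Definition shell : set V := [set x | A / 2 <= enorm x <= 1 + A / 2].

Lemma annulus_shell : annulus A `<=` shell.
Proof. by move=> x /andP[? ?]; apply/andP; split; exact: ltW. Qed.

Lemma coord_le_enorm j (x : V) : `|coord j x| <= enorm x.
Proof.
rewrite -ler_sqr ?nnegrE ?enorm_ge0 // real_normK ?num_real //.
rewrite -sum_coord_sqr (bigD1 j) //= lerDl.
by apply: sumr_ge0 => i _; exact: sqr_ge0.
Qed.

Lemma shell_pos x : shell x -> 0 < enorm x.
Proof. by move=> /andP[h _]; apply: lt_le_trans h; rewrite divr_gt0. Qed.

Lemma annulus_pos (x : V) : annulus A x -> 0 < enorm x.
Proof. by move=> /annulus_shell/shell_pos. Qed.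

Lemma shell_cbox : shell `<=` cbox (point_of (fun=> - (1 + A / 2))) (point_of (fun=> 1 + A / 2)).
Proof.
move=> x /andP[_ h]; apply/cboxP => j; rewrite !coord_point_of -ler_norml.
exact: le_trans (coord_le_enorm j x) h.
Qed.

Lemma compact_shell : compact shell.
Proof.
apply: (subclosed_compact _ (@compact_cbox R _ _) shell_cbox).
have -> : shell = @enorm R @^-1` `[A / 2, 1 + A / 2]%classic.
  by apply/seteqP; split=> x /=; rewrite /shell /= in_itv.
apply: closed_comp; last exact: interval_closed.
by move=> x _; exact: enorm_continuous.
Qed.

Lemma volume_annulus_lty : (volume (annulus A : set M) < +oo)%E.
Proof.
apply: le_lt_trans (volume_cbox (point_of (fun=> - (1 + A / 2))) (point_of (fun=> 1 + A / 2))).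
apply: le_measure; rewrite ?inE.
- exact: open_measurable3 (@open_annulus R A).
- exact: measurable_cbox.
- by move=> x /annulus_shell/shell_cbox.
Qed.

Lemma volume_annulus_neq0 : volume (annulus A : set M) <> 0%E.
Proof.
pose x : V := (1 / 2 + A / 2) *: ev (@Ordinal 3 0 isT).
have Ox : annulus A x.
  rewrite /annulus /= enormZ ger0_norm; last by rewrite addr_ge0 // divr_ge0 // ltW.
  rewrite (_ : enorm _ = 1); first by apply/andP; split; lra.
  by rewrite /enorm /unit_vector /= expr1n expr0n !addr0 sqrtr1.
have [p [q [xpq pqO]]] := rational_box (@open_annulus R A) Ox.
move=> v0; have := volume_obox_gt0 (ex_intro _ x xpq).
rewrite ltNge -v0 => /negP; apply; apply: le_measure; rewrite ?inE.
- exact: measurable_obox.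
- exact: open_measurable3 (@open_annulus R A).
- exact: obox_sub.
Qed.

Local Notation U := [set x : V | 0 < enorm x].

Lemma open_punctured : open (U : set V).
Proof.
have -> : U = @enorm R @^-1` `]0, +oo[%classic.
  by apply/seteqP; split=> x /=; rewrite in_itv /= andbT.
exact: ((continuousP (@enorm R)).1 (@enorm_continuous R)) (interval_open _ _).
Qed.

Lemma bounded_on_annulus (f : V -> R) : Ck ev 0 U f ->
  exists2 N : R, 0 < N & forall x, annulus A x -> `|f x| <= N.
Proof.
move=> Cf; have cf : {within shell, continuous f}.
  apply: continuous_in_subspaceT => x; rewrite inE => /shell_pos.
  exact: Ck_continuous Cf.
have [N N0 bN] := compact_image_bounded compact_shell cf.
by exists N => // x /annulus_shell; exact: bN.
Qed.

Lemma L2_annulus (f : V -> R) : Ck ev 0 U f -> L2 (annulus A) f.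
Proof.
move=> Cf; have [N N0 bN] := bounded_on_annulus Cf.
apply: (L2_bounded _ (N := N) volume_annulus_lty) => //.
  exact: open_measurable3 (@open_annulus R A).
apply: Ck_measurable; first exact: open_annulus.
by apply: Ck_sub Cf => x /annulus_pos.
Qed.

(** Smoothness up to the boundary, here on the punctured space, bounds all
    derivatives on the annulus. *)
Lemma smooth_weak_partial s (u : V -> R) : Ck ev (size s) U u ->
  exists2 g, L2 (annulus A) g & weak_partial (annulus A) s u g.
Proof.
elim: s u => [|i s IH] u Cu.
  by exists u; [exact: L2_annulus|move=> w tw /=; rewrite expr0 mul1r].
have [u' Cu' du'] := Cu.2 i.
have [g Lg hg] := IH u' Cu'; exists g => // w tw.
have AU : annulus A `<=` U by move=> x /annulus_pos.
have Cu1 : Ck ev 1 (annulus A) u by apply: Ck_sub AU (Ck_le _ Cu).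
have := integration_by_parts_test (@open_annulus R A) volume_annulus_lty (i := i)
  Cu1 (fun x Ox => du' x (AU x Ox)) (test_partial s tw).
by rewrite /= => ->; rewrite (hg w tw) exprS mulN1r mulNr.
Qed.

End annulus_geometry.

(** * The ground state and its logarithmic gradient *)

Section ground_state.
Context {R : realType}.
Local Notation V := (R * R * R)%type.
Local Notation M := (measurableTypeR R * measurableTypeR R * measurableTypeR R)%type.
Local Notation ev := (@unit_vector R).
Variable A : R.
Hypothesis A0 : 0 < A.
Local Notation Om := (annulus A : set V).
Local Notation U := [set x : V | 0 < enorm x].
Local Notation inner := (L2_inner Om).

Let oO : open Om. Proof. exact: open_annulus. Qed.
Let mO : measurable (Om : set M). Proof. exact: open_measurable3. Qed.
Let vO : (volume (Om : set M) < +oo)%E. Proof. exact: volume_annulus_lty. Qed.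
Let OU : Om `<=` U. Proof. by move=> x /(annulus_pos A0). Qed.

(** The profile [t |-> psin t / t] vanishes at both radii of the annulus because
    their difference is 1. *)
Definition psin (t : R) : R := sin (pi * (t - A / 2)).
Definition pcos (t : R) : R := cos (pi * (t - A / 2)).

Lemma is_derive_mul (f g : R -> R) (t df dg : R) : is_derive t 1 f df ->
  is_derive t 1 g dg -> is_derive t 1 (fun t => f t * g t) (f t * dg + g t * df).
Proof. exact: is_deriveM. Qed.

Lemma is_derive_sub (f g : R -> R) (t df dg : R) : is_derive t 1 f df ->
  is_derive t 1 g dg -> is_derive t 1 (fun t => f t - g t) (df - dg).
Proof. exact: is_deriveB. Qed.

Lemma is_derive_scale (c : R) (f : R -> R) (t df : R) : is_derive t 1 f df ->
  is_derive t 1 (fun t => c * f t) (c * df).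
Proof.
move=> d; apply: (is_derive_eq (is_derive_mul (is_derive_cst c t (1 : R)) d)).
by rewrite mulr0 addr0.
Qed.

Lemma is_derive_phase (t : R) : is_derive t 1 (fun t : R => pi * (t - A / 2)) pi.
Proof.
have d1 := is_derive_sub (is_derive_id t (1 : R)) (is_derive_cst (A / 2) t (1 : R)).
by apply: (is_derive_eq (is_derive_scale pi d1)); rewrite subr0 mulr1.
Qed.

Lemma is_derive_psin (t : R) : is_derive t 1 psin (pi * pcos t).
Proof.
rewrite mulrC.
exact: (is_derive_scalar_comp (is_derive_sin _) (is_derive_phase t)).
Qed.

Lemma is_derive_pcos (t : R) : is_derive t 1 pcos (- (pi * psin t)).
Proof.
rewrite mulrC -mulNr.
exact: (is_derive_scalar_comp (is_derive_cos _) (is_derive_phase t)).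
Qed.

Lemma psin_gt0 (t : R) : A / 2 < t < 1 + A / 2 -> 0 < psin t.
Proof.
move=> /andP[h1 h2]; have p0 := @pi_gt0 R; apply: sin_gt0_pi; apply/andP; split.
  by rewrite mulr_gt0 // subr_gt0.
by rewrite -[ltRHS]mulr1 ltr_pM2l //; lra.
Qed.

Lemma is_derive_div (f : R -> R) (f' t : R) : t != 0 -> is_derive t 1 f f' ->
  is_derive t 1 (fun t => f t / t) (f' / t - f t / t ^+ 2).
Proof.
move=> t0 df; apply: (is_derive_eq (is_derive_mul df (is_derive_inv t0))).
by field.
Qed.

Definition profile (t : R) : R := psin t / t.
Definition dprofile (t : R) : R := pi * pcos t / t - psin t / t ^+ 2.

Lemma is_derive_profile (t : R) : t != 0 -> is_derive t 1 profile (dprofile t).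
Proof. by move=> t0; exact: (is_derive_div t0 (is_derive_psin t)). Qed.

Lemma is_derive_dprofile (t : R) : t != 0 ->
  is_derive t 1 (fun t => dprofile t / t)
    ((- (pi ^+ 2 * profile t) - 3 * (dprofile t / t)) / t).
Proof.
move=> t0.
have d1 := is_derive_div t0 (is_derive_scale pi (is_derive_pcos t)).
have d2 := is_derive_div t0 (is_derive_div t0 (is_derive_psin t)).
have d3 := is_derive_div t0 (is_derive_sub d1 d2).
have E : (fun t => dprofile t / t) =1
    (fun t : R => ((pi * pcos t) / t - psin t / t / t) / t).
  by move=> s; rewrite /dprofile expr2 invfM mulrA.
rewrite (funext E); apply: (is_derive_eq d3).
by rewrite /profile /dprofile; field.
Qed.

(** The logarithmic derivative of the profile *)
Definition logder (t : R) : R := pi * pcos t / psin t - t^-1.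

Lemma is_derive_logder (t : R) : t != 0 -> psin t != 0 ->
  is_derive t 1 (fun t => logder t / t)
   ((- (pi ^+ 2) - logder t ^+ 2 - 3 * (logder t / t)) / t).
Proof.
move=> t0 s0.
have d1 := is_derive_scale pi (is_derive_pcos t).
have d2 := is_derive_scalar_comp (is_derive_inv s0) (is_derive_psin t).
have d3 := is_derive_div t0 (is_derive_sub (is_derive_mul d1 d2) (is_derive_inv t0)).
apply: (is_derive_eq d3); rewrite /= /logder.
by rewrite /logder; field; rewrite t0 s0.
Qed.

Lemma is_derive_radial (f : R -> R) (f' : R) i (x : V) : 0 < enorm x ->
  is_derive (enorm x) 1 f f' ->
  is_derive x (ev i) (fun y => f (enorm y)) (f' * (coord i x / enorm x)).
Proof. by move=> x0 df; exact: (is_derive_scalar_comp df (is_derive_enorm i x0)). Qed.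

Lemma is_derive_radial_field (f : R -> R) (f' : R) i (x : V) : 0 < enorm x ->
  is_derive (enorm x) 1 f f' ->
  is_derive x (ev i) (fun y => f (enorm y) * coord i y)
    (f' / enorm x * coord i x ^+ 2 + f (enorm x)).
Proof.
move=> x0 df.
have d := is_deriveM (is_derive_radial i x0 df) (is_derive_coord i i x).
apply: (is_derive_eq d); rewrite /GRing.scale /= eqxx mulr1.
by field; rewrite gt_eqF.
Qed.

Definition ground (x : V) : R := profile (enorm x).
Definition dground i (x : V) : R := dprofile (enorm x) / enorm x * coord i x.
Definition ddground i (x : V) : R :=
  (- (pi ^+ 2 * profile (enorm x)) - 3 * (dprofile (enorm x) / enorm x)) / enorm x
   / enorm x * coord i x ^+ 2 + dprofile (enorm x) / enorm x.

Lemma is_derive_ground i (x : V) : 0 < enorm x ->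
  is_derive x (ev i) ground (dground i x).
Proof.
move=> x0; have x0' : enorm x != 0 by rewrite gt_eqF.
apply: (is_derive_eq (is_derive_radial i x0 (is_derive_profile x0'))).
by rewrite /dground; field.
Qed.

Lemma is_derive_dground i (x : V) : 0 < enorm x ->
  is_derive x (ev i) (dground i) (ddground i x).
Proof.
move=> x0; have x0' : enorm x != 0 by rewrite gt_eqF.
exact: (is_derive_radial_field i x0 (is_derive_dprofile x0')).
Qed.

(** The Laplacian of a radial function [f] is [f'' + 2 f' / r]. *)
Lemma sum_ddground (x : V) : 0 < enorm x ->
  \sum_(i < 3) ddground i x = - (pi ^+ 2 * ground x).
Proof.
move=> x0; have x0' : enorm x != 0 by rewrite gt_eqF.
rewrite /ddground big_split /= -big_distrr /= sum_coord_sqr sumr_const card_ord.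
by rewrite -mulr_natr /ground; field.
Qed.

Lemma ground_gt0 (x : V) : Om x -> 0 < ground x.
Proof.
move=> Ox; rewrite /ground /profile divr_gt0 //; last exact: annulus_pos Ox.
exact: psin_gt0.
Qed.

Definition drift i (x : V) : R := logder (enorm x) / enorm x * coord i x.
Definition ddrift i (x : V) : R :=
  (- (pi ^+ 2) - logder (enorm x) ^+ 2 - 3 * (logder (enorm x) / enorm x))
   / enorm x / enorm x * coord i x ^+ 2 + logder (enorm x) / enorm x.

Lemma is_derive_drift i (x : V) : Om x -> is_derive x (ev i) (drift i) (ddrift i x).
Proof.
move=> Ox; have x0 := annulus_pos A0 Ox.
have x0' : enorm x != 0 by rewrite gt_eqF.
have s0 : psin (enorm x) != 0 by rewrite gt_eqF // psin_gt0.
exact: (is_derive_radial_field i x0 (is_derive_logder x0' s0)).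
Qed.

(** The drift is the logarithmic gradient of the ground state. *)
Lemma dground_drift i (x : V) : Om x -> dground i x = drift i x * ground x.
Proof.
move=> Ox; have x0' : enorm x != 0 by rewrite gt_eqF // (annulus_pos A0 Ox).
have s0 : psin (enorm x) != 0 by rewrite gt_eqF // psin_gt0.
by rewrite /dground /drift /ground /dprofile /profile /logder; field; rewrite x0' s0.
Qed.

(** For [V = grad u / u], the sum of [div V] and [|V| ^ 2] is [laplacian u / u]. *)
Lemma riccati (x : V) : Om x ->
  \sum_(i < 3) (ddrift i x + drift i x ^+ 2) = - pi ^+ 2.
Proof.
move=> Ox; have x0' : enorm x != 0 by rewrite gt_eqF // (annulus_pos A0 Ox).
have S2 (c : R) : \sum_(i < 3) c * coord i x ^+ 2 = c * enorm x ^+ 2.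
  by rewrite -sum_coord_sqr big_distrr.
rewrite big_split /= /ddrift big_split /= S2 sumr_const card_ord -mulr_natr.
under [X in _ + X]eq_bigr do rewrite /drift exprMn.
by rewrite S2; field.
Qed.

Lemma Ck1_phase n (D : set R) : Ck1 n D (fun t : R => pi * (t - A / 2)).
Proof. by apply: CkZ; apply: CkB; [exact: Ck1_id|exact: Ck_cst]. Qed.

Lemma Ck_psin n : Ck ev n U (fun x => psin (enorm x)).
Proof.
apply: (@Ck_comp _ _ _ _ n U setT psin) => //; last exact: Ck_enorm.
apply: (@Ck_comp _ _ _ _ n setT setT sin) => //; last exact: Ck1_phase.
exact: (Ck1_sincos n true).
Qed.

Lemma Ck_inv_enorm n : Ck ev n U (fun x => (enorm x)^-1).
Proof. by apply: Ck_inv; [exact: Ck_enorm|move=> x x0; rewrite gt_eqF]. Qed.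

Lemma Ck_ground n : Ck ev n U ground.
Proof. by apply: CkM; [exact: Ck_psin|exact: Ck_inv_enorm]. Qed.

Lemma Ck_dground n i : Ck ev n U (dground i).
Proof.
have [g Cg dg] := (Ck_ground n.+1).2 i.
apply: (Ck_eq (@open_punctured R) _ Cg) => x x0.
by have [_ <-] := dg x x0; have [_ <-] := is_derive_ground i x0.
Qed.

Lemma Ck_drift n i : Ck ev n Om (drift i).
Proof.
have C0 : Ck ev n Om (fun x => dground i x * (ground x)^-1).
  apply: CkM; first exact: Ck_sub OU (Ck_dground n i).
  apply: Ck_inv; first exact: Ck_sub OU (Ck_ground n).
  by move=> x Ox; rewrite gt_eqF // ground_gt0.
apply: (Ck_eq oO _ C0) => x Ox.
by rewrite dground_drift // mulfK // gt_eqF // ground_gt0.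
Qed.

Lemma Ck_ddrift n i : Ck ev n Om (ddrift i).
Proof.
have [g Cg dg] := (Ck_drift n.+1 i).2 i.
apply: (Ck_eq oO _ Cg) => x Ox.
by have [_ <-] := dg x Ox; have [_ <-] := is_derive_drift i Ox.
Qed.

End ground_state.

(** * The energy and Jacobi's identity *)

Section sums_in_L2.
Context {R : realType}.
Local Notation V := (R * R * R)%type.
Local Notation M := (measurableTypeR R * measurableTypeR R * measurableTypeR R)%type.
Variable O : set V.
Hypothesis mO : measurable (O : set M).
Hypothesis vO : (volume (O : set M) < +oo)%E.

Lemma L2_sum (J : Type) (r : seq J) (F : J -> V -> R) : (forall j, L2 O (F j)) ->
  L2 O (fun x => \sum_(j <- r) F j x).
Proof.
move=> LF; elim: r => [|j r IH].
  under eq_fun do rewrite big_nil.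
  by apply: (L2_bounded mO (N := 0) vO) => // x _; rewrite normr0.
by under eq_fun do rewrite big_cons; exact: L2_add.
Qed.

Lemma L2_inner_sumr (J : Type) (r : seq J) (F : J -> V -> R) h :
  (forall j, L2 O (F j)) -> L2 O h ->
  L2_inner O h (fun x => \sum_(j <- r) F j x) = \sum_(j <- r) L2_inner O h (F j).
Proof.
move=> LF Lh; elim: r => [|j r IH].
  rewrite big_nil; under eq_fun do rewrite big_nil.
  rewrite /L2_inner /Rintegral; under eq_integral do rewrite mulr0.
  by rewrite integral0.
rewrite big_cons -IH -L2_innerDr //; last exact: L2_sum.
by apply: eq_L2_inner => x _; rewrite big_cons.
Qed.

End sums_in_L2.

Section energy.
Context {R : realType}.
Local Notation V := (R * R * R)%type.
Local Notation M := (measurableTypeR R * measurableTypeR R * measurableTypeR R)%type.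
Local Notation ev := (@unit_vector R).
Variable A : R.
Hypothesis A0 : 0 < A.
Local Notation Om := (annulus A : set V).
Local Notation U := [set x : V | 0 < enorm x].
Local Notation inner := (L2_inner Om).
Local Notation norm := (L2_norm Om).
Implicit Types (w : V -> R) (i : 'I_3).

Let oO : open Om. Proof. exact: open_annulus. Qed.
Let mO : measurable (Om : set M). Proof. exact: open_measurable3. Qed.
Let vO : (volume (Om : set M) < +oo)%E. Proof. exact: volume_annulus_lty. Qed.

Let L2t w : test_function Om w -> L2 Om w. Proof. exact: L2_test. Qed.

Let L2p s w : test_function Om w -> L2 Om (partial s w).
Proof. by move=> tw; apply: L2t; exact: test_partial. Qed.

Lemma L2_laplacian w : test_function Om w -> L2 Om (fun x => - laplacian w x).
Proof.
move=> tw; apply: L2_opp => //; apply: L2_sum => // i.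
exact: (L2p [:: i; i] tw).
Qed.

Lemma inner_neg_laplacian f w : L2 Om f -> test_function Om w ->
  inner f (fun x => - laplacian w x) = - \sum_(i < 3) inner f (partial [:: i; i] w).
Proof.
move=> Lf tw; have Lp i : L2 Om (partial [:: i; i] w) by exact: L2p.
rewrite -L2_inner_sumr //.
have -> : inner f (fun x => - laplacian w x) = inner f (fun x => -1 * laplacian w x).
  by apply: eq_L2_inner => x _; rewrite mulN1r.
by rewrite L2_innerZr ?mulN1r //; apply: L2_sum.
Qed.

Definition energy w w' : R :=
  \sum_(i < 3) inner (partial [:: i] w) (partial [:: i] w').

Lemma energyE w w' : test_function Om w -> test_function Om w' ->
  inner (fun x => - laplacian w x) w' = energy w w'.
Proof.
move=> tw tw'; rewrite L2_innerC // inner_neg_laplacian //; last exact: L2t.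
rewrite -sumrN; apply: eq_bigr => i _.
have := integration_by_parts_test oO vO (i := i) (f := w') (f' := partial [:: i] w')
  _ (fun x _ => test_is_derive i x tw') (test_partial [:: i] tw).
rewrite [X in X = _](_ : _ = inner w' (partial [:: i; i] w)) // => ->.
  by rewrite opprK L2_innerC.
by apply: Ck_sub (test_Ck 1 tw').
Qed.

Lemma energyC w w' : energy w w' = energy w' w.
Proof. by apply: eq_bigr => i _; rewrite L2_innerC. Qed.

Lemma energy_subl w1 w2 w' : test_function Om w1 -> test_function Om w2 ->
  test_function Om w' -> energy (w1 \- w2) w' = energy w1 w' - energy w2 w'.
Proof.
move=> t1 t2 t'; rewrite /energy -sumrB; apply: eq_bigr => i _.
by rewrite (partial_sub i t1 t2) L2_innerBl //; exact: L2p.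
Qed.

Lemma energy_ge0 w : 0 <= energy w w.
Proof. by apply: sumr_ge0 => i _; exact: L2_inner_ge0. Qed.

Lemma energy_sub_sqr w w' : test_function Om w -> test_function Om w' ->
  energy (w \- w') (w \- w') = energy w w - 2 * energy w w' + energy w' w'.
Proof.
move=> tw tw'; rewrite energy_subl //; last exact: test_sub.
rewrite (energyC w (w \- w')) (energyC w' (w \- w')) !energy_subl // (energyC w' w).
by move: (energy w w) (energy w w') (energy w' w') => a b c; ring.
Qed.

Lemma energy_norm w : energy w w = \sum_(i < 3) norm (partial [:: i] w) ^+ 2.
Proof. by apply: eq_bigr => i _; rewrite sqr_L2_norm. Qed.

(** The derivative of [w / ground], multiplied by [ground] *)
Definition log_grad i w (x : V) : R := partial [:: i] w x - drift A i x * w x.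

Lemma test_sqr w : test_function Om w -> test_function Om (w \* w).
Proof.
move=> tw; have [_ [K [cK KO w0]]] := tw; split.
  by apply/smooth_Ck => n; apply: CkM; exact: test_Ck tw.
by exists K; split => // x Kx /=; rewrite w0 // mulr0.
Qed.

Lemma L2_log_grad i w : test_function Om w -> L2 Om (log_grad i w).
Proof.
move=> tw; apply: L2_sub => //; first exact: L2p.
by apply: (L2_mul_test oO vO) => //; exact: Ck_drift.
Qed.

(** Jacobi's identity. In the expansion of the squares the mixed term is
    [- V . grad (w ^+ 2)], where [V] is the drift; an integration by parts turns it
    into [div V * w ^+ 2], and Riccati's equation collects the terms in [w ^+ 2].
    Since [log_grad i w] is [ground] times the derivative of [w / ground], the
    identity compares [w] with the ground state. *)
Lemma jacobi_identity w : test_function Om w ->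
  \sum_(i < 3) norm (log_grad i w) ^+ 2 = energy w w - pi ^+ 2 * inner w w.
Proof.
move=> tw.
have Ld i : L2 Om (drift A i \* w) by apply: (L2_mul_test oO vO) => //; exact: Ck_drift.
have Ldd i : L2 Om (fun x => ddrift A i x * w x + drift A i x ^+ 2 * w x).
  apply: L2_add => //; apply: (L2_mul_test oO vO) => //; first exact: Ck_ddrift.
  by apply: (@CkM _ _ _ ev 0 Om) => //; exact: Ck_drift.
have Lw := L2t tw; have Lp i : L2 Om (partial [:: i] w) by exact: L2p.
have term i : norm (log_grad i w) ^+ 2 = inner (partial [:: i] w) (partial [:: i] w)
    + inner w (fun x => ddrift A i x * w x + drift A i x ^+ 2 * w x).
  rewrite sqr_L2_norm /log_grad.
  rewrite [LHS](L2_sub_sqr mO (Lp i) (Ld i)) -addrA; congr (_ + _).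
  have dw2 x : partial [:: i] (w \* w) x = 2 * (w x * partial [:: i] w x).
    have d := test_is_derive i x tw; have [_] := is_deriveM d d.
    by rewrite /GRing.scale /= => ->; ring.
  have := integration_by_parts_test oO vO (Ck_drift A0 1 i)
    (fun x Ox => is_derive_drift A0 i Ox) (test_sqr tw).
  have -> : inner (drift A i) (partial [:: i] (w \* w)) =
      2 * inner (partial [:: i] w) (drift A i \* w).
    rewrite -L2_innerZl //; apply: eq_L2_inner => x _.
    by rewrite dw2 /=; ring.
  have -> : inner (ddrift A i) (w \* w) = inner w (fun x => ddrift A i x * w x).
    by apply: eq_L2_inner => x _ /=; ring.
  move=> ->; rewrite opprK.
  have -> : inner (drift A i \* w) (drift A i \* w) =
      inner w (fun x => drift A i x ^+ 2 * w x).
    by apply: eq_L2_inner => x _ /=; ring.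
  rewrite -L2_innerDr //; apply: (L2_mul_test oO vO) => //; first exact: Ck_ddrift.
  by apply: (@CkM _ _ _ ev 0 Om) => //; exact: Ck_drift.
under eq_bigr do rewrite term.
rewrite big_split /=; congr (_ + _).
rewrite -L2_inner_sumr // -mulNr -L2_innerZr //; apply: eq_L2_inner => x Ox.
rewrite -(riccati A0 Ox) big_distrl /=; congr (_ * _); apply: eq_bigr => i _.
by ring.
Qed.

Lemma pi2_le_energy w : test_function Om w -> pi ^+ 2 * inner w w <= energy w w.
Proof.
move=> tw; rewrite -subr_ge0 -jacobi_identity //.
by apply: sumr_ge0 => i _; exact: sqr_ge0.
Qed.

End energy.

(** * The ground state is an eigenvector *)

Section truncation.
Context {R : realType}.
Local Notation V := (R * R * R)%type.
Local Notation M := (measurableTypeR R * measurableTypeR R * measurableTypeR R)%type.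
Local Notation ev := (@unit_vector R).
Variable A : R.
Hypothesis A0 : 0 < A.
Local Notation Om := (annulus A : set V).
Local Notation U := [set x : V | 0 < enorm x].
Local Notation phi := (ground A).

Let oO : open Om. Proof. exact: open_annulus. Qed.
Let mO : measurable (Om : set M). Proof. exact: open_measurable3. Qed.
Let vO : (volume (Om : set M) < +oo)%E. Proof. exact: volume_annulus_lty. Qed.
Let OU : Om `<=` U. Proof. by move=> x /(annulus_pos A0). Qed.

(** A smooth function that vanishes for [s <= n.+1%:R^-1], tends to [s], and
    has a derivative bounded uniformly in [n]: composed with the ground state, it
    gives test functions converging in the Sobolev norm. *)
Definition cut (n : nat) (s : R) : R := s * flat 0 (n.+1%:R * s - 1).
Definition dcut (n : nat) (s : R) : R :=
  flat 0 (n.+1%:R * s - 1) + flat 1 (n.+1%:R * s - 1) + flat 2 (n.+1%:R * s - 1).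

Lemma is_derive_cut n (s : R) : is_derive s 1 (cut n) (dcut n s).
Proof.
have d1 : is_derive s 1 (fun t : R => n.+1%:R * t - 1) n.+1%:R.
  apply: (is_derive_eq (is_derive_sub (is_derive_scale n.+1%:R (is_derive_id s (1 : R)))
    (is_derive_cst (1 : R) s (1 : R)))).
  by rewrite mulr1 subr0.
have d2 := @is_derive_scalar_comp R R (fun t => n.+1%:R * t - 1) (flat 0) s 1 _ _
  (is_derive_flat 0 _) d1.
have d3 := is_derive_mul (is_derive_id s (1 : R)) d2.
apply: (is_derive_eq d3); rewrite /dcut /= (flat_mul 1); ring.
Qed.

Lemma Ck1_cut m n : Ck1 m setT (cut n).
Proof.
by apply: CkM; [exact: Ck1_id|exact: (@Ck1_flat_affine R m 0 n.+1%:R (- 1))].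
Qed.

Lemma cut_small n (s : R) : s <= n.+1%:R^-1 -> cut n s = 0.
Proof.
move=> sn; rewrite /cut flat_le0 ?mulr0 // subr_le0 mulrC.
by rewrite -ler_pdivlMr ?ltr0n // div1r.
Qed.

Lemma affine_cvg (s : R) : 0 < s -> (n.+1%:R * s - 1) @[n --> \oo] --> +oo.
Proof. by move=> s0; have := cvg_affine_pinfty s0; rewrite -cvg_shiftS. Qed.

Lemma cut_cvg (s : R) : 0 < s -> cut n s @[n --> \oo] --> s.
Proof.
move=> s0; rewrite -[X in _ --> X](mulr1 s).
by apply: cvgM; [exact: cvg_cst|exact: flat0_cvg (affine_cvg s0)].
Qed.

Lemma dcut_cvg (s : R) : 0 < s -> dcut n s @[n --> \oo] --> (1 : R).
Proof.
move=> s0; rewrite -[X in _ --> X]addr0 -[X in _ --> X]addr0.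
apply: cvgD; first apply: cvgD.
- exact: flat0_cvg (affine_cvg s0).
- exact: flatS_cvg (affine_cvg s0).
- exact: flatS_cvg (affine_cvg s0).
Qed.

Lemma cut_dist n (s : R) : 0 <= s -> `|cut n s - s| <= s.
Proof.
move=> s0; rewrite /cut distrC ger0_norm.
  by rewrite gerBl mulr_ge0 // flat_ge0.
by rewrite subr_ge0 ler_piMr // flat0_le1.
Qed.

Lemma dcut_dist n (s : R) : `|dcut n s - 1| <= 1 + 2 ^+ 2 + 3 ^+ 3.
Proof.
have h0 := flat0_le1 (n.+1%:R * s - 1); have h1 := flat_le 1 (n.+1%:R * s - 1).
have h2 := flat_le 2 (n.+1%:R * s - 1).
have g0 := flat_ge0 0 (n.+1%:R * s - 1); have g1 := flat_ge0 1 (n.+1%:R * s - 1).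
have g2 := flat_ge0 2 (n.+1%:R * s - 1).
by rewrite ler_norml /dcut; apply/andP; split; lra.
Qed.

Definition trunc n : V -> R := (fun x => cut n (phi x)) \_ Om.

Lemma truncE n x : Om x -> trunc n x = cut n (phi x).
Proof. by move=> Ox; rewrite /trunc patchE mem_set. Qed.

(** Described by [psin], continuous on the whole space, rather than by the ground
    state, which is not; [A / 2] is a lower bound of the norm in the annulus. *)
Definition trunc_support n : set V :=
  [set x | shell A x /\ A / 2 / n.+1%:R <= psin A (enorm x)].

Lemma trunc_support_annulus n : trunc_support n `<=` Om.
Proof.
move=> x [/andP[x1 x2] sx]; have n0 : 0 < A / 2 / n.+1%:R.
  by rewrite !divr_gt0 // ltr0n.
rewrite /annulus /= !lt_neqAle x1 x2 !andbT; apply/andP; split.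
  apply: contraTneq sx => <-; rewrite -ltNge.
  by rewrite /psin subrr mulr0 sin0.
apply: contraTneq sx => ->; rewrite -ltNge.
by rewrite /psin addrK mulr1 sinpi.
Qed.

Lemma psin_continuous : continuous (fun x : V => psin A (enorm x)).
Proof.
move=> x; apply: continuous_comp; first exact: enorm_continuous.
apply: differentiable_continuous; apply/derivable1_diffP.
by have [] := is_derive_psin A (enorm x).
Qed.

Lemma compact_trunc_support n : compact (trunc_support n).
Proof.
have sub : trunc_support n `<=` shell A by move=> x [].
apply: (subclosed_compact _ (@compact_shell R A) sub).
have -> : trunc_support n = @enorm R @^-1` `[A / 2, 1 + A / 2]%classic `&`
    (fun x : V => psin A (enorm x)) @^-1` `[A / 2 / n.+1%:R, +oo[%classic.
  apply/seteqP; split=> x; rewrite /trunc_support /shell /= !in_itv /= andbT.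
    by [].
  by [].
apply: closedI.
  apply: closed_comp; last exact: interval_closed.
  by move=> x _; exact: enorm_continuous.
apply: closed_comp; last exact: interval_closed.
by move=> x _; exact: psin_continuous.
Qed.

Lemma trunc_out n x : ~ trunc_support n x -> trunc n x = 0.
Proof.
move=> Kx; rewrite /trunc patchE; case: ifPn => //; rewrite inE => Ox.
apply: cut_small; have x0 := annulus_pos A0 Ox.
rewrite /ground /profile ler_pdivrMr // leNgt; apply/negP => h; apply: Kx.
split; first exact: annulus_shell.
rewrite ltW // (le_lt_trans _ h) // mulrC ler_pM2l ?invr_gt0 ?ltr0n //.
by have /andP[/ltW] := Ox.
Qed.

Lemma Ck_trunc m n : Ck ev m Om (trunc n).
Proof.
have C0 : Ck ev m Om (cut n \o phi).
  by apply: (Ck_comp (Ck1_cut m n)) => //; exact: Ck_sub OU (Ck_ground A m).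
by apply: (Ck_eq oO _ C0) => x Ox; rewrite truncE.
Qed.

Lemma trunc_test n : test_function Om (trunc n).
Proof.
split; last first.
  exists (trunc_support n); split; first exact: compact_trunc_support.
    exact: trunc_support_annulus.
  exact: trunc_out.
apply/smooth_Ck => m; apply: (Ck_glue oO _ (@trunc_support_annulus n) (@trunc_out n)).
  exact: (compact_closed (@norm_hausdorff _ _) (@compact_trunc_support n)).
exact: Ck_trunc.
Qed.

Lemma partial_trunc n i x : Om x ->
  partial [:: i] (trunc n) x = dcut n (phi x) * dground A i x.
Proof.
move=> Ox; have d := is_derive_scalar_comp (is_derive_cut n (phi x))
  (is_derive_ground A i (annulus_pos A0 Ox)).
have nE : \forall y \near x, (cut n \o phi) y = trunc n y.
  by near=> y; rewrite truncE //; near: y; exact: open_nbhs_nbhs.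
by have [_] := near_eq_is_derive nE d.
Unshelve. all: by end_near. Qed.

Lemma L2_ground : L2 Om phi.
Proof. by apply: L2_annulus => //; exact: Ck_ground. Qed.

Lemma L2_dground i : L2 Om (dground A i).
Proof. by apply: L2_annulus => //; exact: Ck_dground. Qed.

Lemma trunc_cvg : L2_cvg Om trunc phi.
Proof.
have [N N0 bN] := bounded_on_annulus A0 (Ck_ground A 0).
apply: (L2_cvg_bounded mO (N := N) vO) => [n|||].
- exact: (L2_test oO vO (trunc_test n)).
- exact: L2_ground.
- move=> n x Ox; rewrite truncE //; apply: le_trans (bN x Ox).
  by have g0 := ground_gt0 A0 Ox; rewrite [leRHS]gtr0_norm // cut_dist // ltW.
- move=> x Ox; under eq_fun do rewrite truncE //.
  exact/cut_cvg/ground_gt0.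
Qed.

Lemma partial_trunc_cvg i :
  L2_cvg Om (fun n => partial [:: i] (trunc n)) (dground A i).
Proof.
have [N N0 bN] := bounded_on_annulus A0 (Ck_dground A 0 i).
pose B : R := 1 + 2 ^+ 2 + 3 ^+ 3.
apply: (L2_cvg_bounded mO (N := B * N) vO) => [n|||].
- exact: (L2_test oO vO (test_partial [:: i] (trunc_test n))).
- exact: L2_dground.
- move=> n x Ox; rewrite partial_trunc //.
  rewrite -[X in _ - X]mul1r -mulrBl normrM.
  by apply: ler_pM => //; [exact: dcut_dist|exact: bN].
- move=> x Ox; under eq_fun do rewrite partial_trunc //.
  have : dcut n (phi x) * dground A i x @[n --> \oo] --> 1 * dground A i x.
    by apply: cvgM; [exact/dcut_cvg/ground_gt0|exact: cvg_cst].
  by rewrite mul1r.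
Qed.

Lemma weak_partial_ground i : weak_partial Om [:: i] phi (dground A i).
Proof.
move=> w tw; rewrite expr1 mulN1r.
apply: (integration_by_parts_test oO vO) => //.
  exact: Ck_sub OU (Ck_ground A 1).
by move=> x /OU; exact: is_derive_ground.
Qed.

Lemma ground_sobolev k : sobolev Om k phi.
Proof.
split; first exact: L2_ground.
by move=> s _; apply: smooth_weak_partial => //; exact: Ck_ground.
Qed.

Lemma sub_sqr_le (f g h : V -> R) : L2 Om f -> L2 Om g -> L2 Om h ->
  L2_norm Om (f \- g) ^+ 2 <=
  2 * L2_norm Om (f \- h) ^+ 2 + 2 * L2_norm Om (g \- h) ^+ 2.
Proof.
move=> Lf Lg Lh; have La := L2_sub Lf Lh; have Lb := L2_sub Lg Lh.
have -> : L2_norm Om (f \- g) = L2_norm Om ((f \- h) \- (g \- h)).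
  by congr Num.sqrt; apply: eq_L2_inner => x _ /=; ring.
rewrite [X in X <= _]sqr_L2_norm L2_sub_sqr // -!sqr_L2_norm.
have /ler_normlP[h1 _] := cauchy_schwarz mO La Lb.
move: h1 (L2_norm_ge0 Om (f \- h)) (L2_norm_ge0 Om (g \- h)).
move: (L2_norm Om (f \- h)) (L2_norm Om (g \- h)) (L2_inner _ _ _) => a b c.
have := sqr_ge0 (a - b); rewrite sqrrB; nra.
Qed.

Lemma L2_norm_ae_eq (f g : V -> R) : L2 Om f -> L2 Om g -> ae_on Om f g ->
  L2_norm Om f = L2_norm Om g.
Proof.
move=> Lf Lg fg; congr (Num.sqrt (fine _)).
have m2 h : L2 Om h -> measurable_fun (Om : set M) (fun x : M => (h x * h x)%:E).
  by move=> Lh; exact: measurable_int (L2_mul_integrable mO Lh Lh).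
apply: ae_eq_integral => //; try exact: m2.
by apply: filterS fg => x fgx Ox; rewrite fgx.
Qed.

Lemma L2_cvg_ae_eq (v : (V -> R)^nat) (u u' : V -> R) : (forall n, L2 Om (v n)) ->
  L2 Om u -> L2 Om u' -> ae_on Om u u' -> L2_cvg Om v u -> L2_cvg Om v u'.
Proof.
move=> Lv Lu Lu' uu' /(L2_cvgP mO Lv Lu) h; apply/(L2_cvgP mO Lv Lu').
have -> : (fun n => L2_norm Om (v n \- u')) = (fun n => L2_norm Om (v n \- u)) => //.
apply/funext => n; apply: L2_norm_ae_eq; try exact: L2_sub.
by apply: filterS uu' => x ux Ox /=; rewrite ux.
Qed.

(** Weak derivatives are unique up to null sets, so that it suffices to approximate
    the classical ones. *)
Lemma ground_sobolev0 : sobolev0 Om 1 phi.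
Proof.
split; first exact: ground_sobolev.
exists trunc; first exact: trunc_test.
move=> [|i [|//]] g sz Lg hg.
  apply: (L2_cvg_ae_eq _ L2_ground Lg _ trunc_cvg) => [n|].
    exact: (L2_test oO vO (trunc_test n)).
  apply: (weak_partial_unique oO L2_ground Lg _ hg) => [w tw|w].
    by rewrite /= expr0 mul1r.
  exact: L2_test.
apply: (L2_cvg_ae_eq _ (L2_dground i) Lg _ (partial_trunc_cvg i)) => [n|].
  exact: (L2_test oO vO (test_partial [:: i] (trunc_test n))).
apply: (weak_partial_unique oO (L2_dground i) Lg (weak_partial_ground i) hg).
by move=> w; exact: L2_test.
Qed.

Lemma ground_friedrichs :
  friedrichs Om (test_function Om) (fun w x => - laplacian w x) phi
    (fun x => pi ^+ 2 * phi x).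
Proof.
split; first exact: L2_ground.
- exact/L2_scale/L2_ground.
- exists trunc; split; [exact: trunc_test|exact: trunc_cvg|].
  move=> e e0.
  have Lp i n : L2 Om (partial [:: i] (trunc n)).
    exact: (L2_test oO vO (test_partial [:: i] (trunc_test n))).
  pose s n := \sum_(i < 3) L2_norm Om (partial [:: i] (trunc n) \- dground A i) ^+ 2.
  have s0 : s n @[n --> \oo] --> (0 : R).
    rewrite /s -[X in _ --> X](_ : \sum_(i < 3) (0 : R) = _); last by rewrite big1.
    apply: cvg_big => [|i _]; first exact: add_continuous.
    have h := (L2_cvgP mO (Lp i) (L2_dground i)).1 (partial_trunc_cvg i).
    rewrite -[X in _ --> X](expr0n R 2); under eq_fun do rewrite expr2.
    by rewrite expr2; exact: cvgM.
  have [N _ sN] : \forall n \near \oo, s n < e / 4.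
    by apply: (cvgr_lt _ s0); rewrite divr_gt0.
  exists N => m n Nm Nn; have tm := trunc_test m; have tn := trunc_test n.
  rewrite energyE //; try exact: test_sub.
  rewrite energy_norm; apply: (@le_lt_trans _ _ (2 * s m + 2 * s n)).
    have sum_le (F G H : 'I_3 -> R) : (forall i, F i <= 2 * G i + 2 * H i) ->
        \sum_(i < 3) F i <= 2 * (\sum_(i < 3) G i) + 2 * (\sum_(i < 3) H i).
      by move=> FGH; rewrite !mulr_sumr -big_split /=; apply: ler_sum.
    apply: sum_le => i.
    by rewrite (partial_sub i tm tn); apply: sub_sqr_le => //; exact: L2_dground.
  have := sN m Nm; have := sN n Nn; rewrite /=; move: (s m) (s n) => a b; lra.
- move=> w tw; rewrite inner_neg_laplacian //; last exact: L2_ground.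
  have Ldd i : L2 Om (ddground A i).
    have [g Cg dg] := (Ck_dground A 1 i).2 i.
    apply: L2_annulus => //; apply: (Ck_eq (@open_punctured R) _ (Cg : Ck ev 0 U g)) => x x0.
    by have [_ <-] := dg x x0; have [_ <-] := is_derive_dground A i x0.
  have term i : L2_inner Om phi (partial [:: i; i] w) = L2_inner Om w (ddground A i).
    have := weak_partial_ground i (test_partial [:: i] tw).
    rewrite expr1 mulN1r [LHS](_ : _ = L2_inner Om phi (partial [:: i; i] w)) // => ->.
    have C1 : Ck ev 1 Om (dground A i) by exact: Ck_sub OU (Ck_dground A 1 i).
    rewrite (integration_by_parts_test oO vO C1
      (fun x Ox => is_derive_dground A i (OU Ox)) tw).
    by rewrite opprK L2_innerC.
  under eq_bigr do rewrite term.
  rewrite -L2_inner_sumr //; last exact: (L2_test oO vO tw).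
  rewrite -mulN1r -L2_innerZr //; last 2 first.
  - exact: L2_sum.
  - exact: (L2_test oO vO tw).
  rewrite L2_innerC; apply: eq_L2_inner => x /OU x0.
  by rewrite sum_ddground // mulN1r opprK.
Qed.

Lemma ground_eigenvector : eigenspace_op A (pi ^+ 2) phi.
Proof.
by split; [exact: ground_sobolev0|exact: ground_sobolev|exact: ground_friedrichs].
Qed.

Lemma ground_neq0 : ~ ae_on Om phi (cst 0).
Proof.
move=> [N [mN N0 h]]; apply: (volume_annulus_neq0 A0); apply/eqP.
rewrite -measure_le0 -N0; apply: le_measure; rewrite ?inE //.
move=> x Ox; apply: h => /(_ Ox) /= E.
by have := ground_gt0 A0 Ox; rewrite E ltxx.
Qed.

End truncation.

(** * Lower bound and simplicity *)

Section spectrum.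
Context {R : realType}.
Local Notation V := (R * R * R)%type.
Local Notation M := (measurableTypeR R * measurableTypeR R * measurableTypeR R)%type.
Local Notation ev := (@unit_vector R).
Variable A : R.
Hypothesis A0 : 0 < A.
Local Notation Om := (annulus A : set V).
Local Notation U := [set x : V | 0 < enorm x].
Local Notation phi := (ground A).
Local Notation inner := (L2_inner Om).
Local Notation norm := (L2_norm Om).

Let oO : open Om. Proof. exact: open_annulus. Qed.
Let mO : measurable (Om : set M). Proof. exact: open_measurable3. Qed.
Let vO : (volume (Om : set M) < +oo)%E. Proof. exact: volume_annulus_lty. Qed.
Let OU : Om `<=` U. Proof. by move=> x /(annulus_pos A0). Qed.
Let L2t w : test_function Om w -> L2 Om w. Proof. exact: L2_test. Qed.
Let L2p s w : test_function Om w -> L2 Om (partial s w).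
Proof. by move=> tw; apply: L2t; exact: test_partial. Qed.

Lemma L2_inner_eq0 (f : V -> R) : L2 Om f -> inner f f = 0 -> ae_on Om f (cst 0).
Proof.
move=> Lf f0; have iff := L2_mul_integrable mO Lf Lf.
have E0 : (\int[volume]_(x in Om) `|(f x * f x)%:E| = 0)%E.
  have -> : (\int[volume]_(x in Om) `|(f x * f x)%:E| =
      \int[volume]_(x in Om) (f x * f x)%:E)%E.
    by apply: eq_integral => x _; rewrite gee0_abs // lee_fin -expr2 sqr_ge0.
  by rewrite -(fineK (integrable_fin_num mO iff)); congr EFin; exact: f0.
have [+ _] := ae_eq_integral_abs (@volume R) mO (measurable_int _ iff).
move=> /(_ E0); apply: filterS => x h Ox.
have /eqP := h Ox; rewrite eqe => /eqP.
by move=> /eqP; rewrite mulf_eq0 orbb => /eqP.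
Qed.

(** The Cauchy-Schwarz inequality for the energy, in a form without square roots *)
Lemma energy_amgm (w w' : V -> R) (t : R) : test_function Om w ->
  test_function Om w' -> 0 < t ->
  `|energy A w w'| <= (energy A w w / t + t * energy A w' w') / 2.
Proof.
move=> tw tw' t0.
have amgm (a b : R) : a * b <= (a ^+ 2 / t + t * b ^+ 2) / 2.
  have -> : a ^+ 2 / t + t * b ^+ 2 = (a ^+ 2 + (t * b) ^+ 2) / t.
    by field; rewrite gt_eqF.
  by rewrite !ler_pdivlMr //; have := sqr_ge0 (a - t * b); rewrite sqrrB; lra.
have distr (F G : 'I_3 -> R) : \sum_(i < 3) (F i / t + t * G i) / 2 =
    ((\sum_(i < 3) F i) / t + t * (\sum_(i < 3) G i)) / 2.
  by rewrite -mulr_suml big_split /= -mulr_suml -mulr_sumr.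
rewrite !energy_norm -distr.
have tri : `|energy A w w'| <=
    \sum_(i < 3) `|inner (partial [:: i] w) (partial [:: i] w')|.
  exact: ler_norm_sum.
apply: (le_trans tri); apply: ler_sum => i _.
apply: le_trans (amgm (norm (partial [:: i] w)) (norm (partial [:: i] w'))).
by apply: cauchy_schwarz => //; exact: L2p.
Qed.

Section eigenvector.
Variables (lam : R) (v : V -> R) (w : (V -> R)^nat).
Hypothesis Lv : L2 Om v.
Hypothesis tw : forall n, test_function Om (w n).
Hypothesis wv : L2_cvg Om w v.
Hypothesis wC : forall e : R, 0 < e -> exists N : nat, forall m n,
  (N <= m)%N -> (N <= n)%N -> energy A (w m \- w n) (w m \- w n) < e.
Hypothesis veq : forall psi, test_function Om psi ->
  inner v (fun x => - laplacian psi x) = lam * inner v psi.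

(** The eigenvalue equation tested against [w n] *)
Lemma energy_cvg_aux n : energy A (w m) (w n) @[m --> \oo] --> lam * inner v (w n).
Proof.
rewrite -veq //.
have -> : (fun m => energy A (w m) (w n)) =
    (fun m => inner (w m) (fun x => - laplacian (w n) x)).
  by apply/funext => m; rewrite energyC -energyE // L2_innerC.
by apply: L2_inner_cvg => //; [move=> m; exact: L2t|exact: L2_laplacian].
Qed.

Lemma energy_bounded : exists2 B : R, 0 < B &
  exists N : nat, forall n, (N <= n)%N -> energy A (w n) (w n) <= B.
Proof.
have [N hN] := wC (@ltr01 R).
exists (2 + 2 * energy A (w N) (w N)).
  by have := energy_ge0 A (w N); lra.
exists N => n Nn; have := hN n N Nn (leqnn N).
rewrite energy_sub_sqr //.
have := energy_amgm (tw n) (tw N) (@ltr0Sn R 1).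
have := energy_ge0 A (w n); have := energy_ge0 A (w N).
move: (energy A _ _) (energy A _ _) (energy A _ _) => b a c a0 b0 /ler_normlP[_]; lra.
Qed.

(** The energies converge to [lam * inner v v] because the difference between
    [energy (w m) (w n)], whose limit in [m] is known, and [energy (w n) (w n)] is
    small, [w] being a Cauchy sequence for the energy. *)
Lemma energy_cvg : energy A (w n) (w n) @[n --> \oo] --> lam * inner v v.
Proof.
have vw : lam * inner v (w n) @[n --> \oo] --> lam * inner v v.
  apply: cvgM; first exact: cvg_cst.
  under eq_fun do rewrite L2_innerC.
  by apply: L2_inner_cvg => // n; exact: L2t.
have d0 : energy A (w n) (w n) - lam * inner v (w n) @[n --> \oo] --> (0 : R).
  have [B B0 [N0 hB]] := energy_bounded.
  apply/cvgr0Pnorm_le => e e0.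
  have [N hN] := wC (divr_gt0 (exprn_gt0 2 e0) B0).
  exists (maxn N N0) => // n; rewrite /= geq_max => /andP[Nn N0n].
  have lim : `|energy A (w m) (w n) - energy A (w n) (w n)| @[m --> \oo] -->
      `|lam * inner v (w n) - energy A (w n) (w n)|.
    by apply: cvg_norm; apply: cvgB; [exact: energy_cvg_aux|exact: cvg_cst].
  have lime : (fun=> e) @ \oo --> e by exact: cvg_cst.
  rewrite /= distrC; apply: (ler_cvg_to lim lime).
  exists N => // m /= Nm.
  rewrite -energy_subl //.
  have tp : 0 < e / B by exact: divr_gt0.
  apply: le_trans (energy_amgm (test_sub (tw m) (tw n)) (tw n) tp) _.
  have h1 := ltW (hN m n Nm Nn); have h2 := hB n N0n.
  rewrite ler_pdivrMr // mulr_natr mulr2n; apply: lerD.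
    rewrite ler_pdivrMr // (_ : e * (e / B) = e ^+ 2 / B) //.
    by rewrite expr2 mulrA.
  by rewrite mulrAC ler_pdivrMr // ler_pM2l.
have : (energy A (w n) (w n) - lam * inner v (w n)) + lam * inner v (w n)
    @[n --> \oo] --> 0 + lam * inner v v by exact: cvgD.
by rewrite add0r; under eq_fun do rewrite subrK.
Qed.

Lemma pi2_le_eigenvalue : ~ ae_on Om v (cst 0) -> pi ^+ 2 <= lam.
Proof.
move=> v0; have vv : 0 < inner v v.
  rewrite lt0r L2_inner_ge0 andbT; apply/eqP => vv0; apply: v0.
  exact: L2_inner_eq0.
rewrite -(ler_pM2r vv).
have h1 : pi ^+ 2 * inner (w n) (w n) @[n --> \oo] --> pi ^+ 2 * inner v v.
  apply: cvgM; first exact: cvg_cst.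
  by apply: L2_sqr_cvg => // n; exact: L2t.
apply: (ler_cvg_to h1 energy_cvg); apply: nearW => n.
exact: pi2_le_energy.
Qed.

(** The limit of Jacobi's identity along [w] *)
Lemma log_grad_cvg i : lam = pi ^+ 2 ->
  norm (log_grad A i (w n)) @[n --> \oo] --> (0 : R).
Proof.
move=> lamE.
have h1 : pi ^+ 2 * inner (w n) (w n) @[n --> \oo] --> pi ^+ 2 * inner v v.
  apply: cvgM; first exact: cvg_cst.
  by apply: L2_sqr_cvg => // n; exact: L2t.
have h2 : energy A (w n) (w n) - pi ^+ 2 * inner (w n) (w n) @[n --> \oo] --> (0 : R).
  have h0 := energy_cvg; rewrite lamE in h0.
  by rewrite -(subrr (pi ^+ 2 * inner v v)); exact: cvgB h0 h1.
have h3 : norm (log_grad A i (w n)) ^+ 2 @[n --> \oo] --> (0 : R).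
  apply: (@squeeze_cvgr _ _ _ _ (cst 0) _ _ _ _ _ h2); last exact: cvg_cst.
  apply: nearW => n; rewrite sqr_ge0 /= -[leRHS](jacobi_identity A0) //.
  rewrite (bigD1 i) //= lerDl; apply: sumr_ge0 => j _; exact: sqr_ge0.
have h4 : Num.sqrt (norm (log_grad A i (w n)) ^+ 2) @[n --> \oo] --> Num.sqrt (0 : R).
  by apply: continuous_cvg h3; exact: sqrt_continuous.
rewrite sqrtr0 in h4; move: h4.
by under eq_fun do rewrite sqrtr_sqr ger0_norm ?L2_norm_ge0 //.
Qed.

Lemma Ck_inv_ground n : Ck ev n Om (fun x => (phi x)^-1).
Proof.
apply: Ck_inv; first exact: Ck_sub OU (Ck_ground A n).
by move=> x Ox; rewrite gt_eqF // ground_gt0.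
Qed.

Lemma is_derive_quotient i (psi : V -> R) x : test_function Om psi -> Om x ->
  is_derive x (ev i) (fun x => (phi x)^-1 * psi x)
    ((phi x)^-1 * log_grad A i psi x).
Proof.
move=> tpsi Ox; have p0 : phi x != 0 by rewrite gt_eqF // ground_gt0.
have d1 := is_derive_scalar_comp (is_derive_inv p0) (is_derive_ground A i (OU Ox)).
apply: (is_derive_eq (is_deriveM d1 (test_is_derive i x tpsi))).
rewrite /GRing.scale /= (dground_drift A0 i Ox) /log_grad /=.
by field.
Qed.

(** By integration by parts the pairing with [w n / ground] is one with
    [log_grad i (w n)], which tends to zero. *)
Lemma quotient_gradient_free i psi : lam = pi ^+ 2 -> test_function Om psi ->
  inner (fun x => (phi x)^-1 * v x) (partial [:: i] psi) = 0.
Proof.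
move=> lamE tpsi; have C0 := Ck_inv_ground 0.
have Lpsi : L2 Om (fun x => (phi x)^-1 * psi x) by exact: (L2_mul_test oO vO C0 tpsi).
have Ldpsi : L2 Om (fun x => (phi x)^-1 * partial [:: i] psi x).
  exact: (L2_mul_test oO vO C0 (test_partial [:: i] tpsi)).
have -> : inner (fun x => (phi x)^-1 * v x) (partial [:: i] psi) =
    inner v (fun x => (phi x)^-1 * partial [:: i] psi x).
  by apply: eq_L2_inner => x _; rewrite mulrCA mulrA.
have wE n : inner (w n) (fun x => (phi x)^-1 * partial [:: i] psi x) =
    - inner (log_grad A i (w n)) (fun x => (phi x)^-1 * psi x).
  have C1 : Ck ev 1 Om (fun x => (phi x)^-1 * w n x).
    by apply: (CkM (Ck_inv_ground 1)); apply: Ck_sub (test_Ck 1 (tw n)).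
  have := integration_by_parts_test oO vO C1
    (fun x Ox => is_derive_quotient i (tw n) Ox) tpsi.
  have -> : inner (fun x => (phi x)^-1 * w n x) (partial [:: i] psi) =
      inner (w n) (fun x => (phi x)^-1 * partial [:: i] psi x).
    by apply: eq_L2_inner => x _; rewrite mulrCA mulrA.
  by move=> ->; congr (- _); apply: eq_L2_inner => x _; rewrite mulrCA mulrA.
have lim1 := L2_inner_cvg mO (fun n => L2t (tw n)) Lv wv Ldpsi.
have lim0 : inner (w n) (fun x => (phi x)^-1 * partial [:: i] psi x)
    @[n --> \oo] --> (0 : R).
  apply: norm_cvg0.
  have h : norm (log_grad A i (w n)) * norm (fun x => (phi x)^-1 * psi x)
      @[n --> \oo] --> (0 : R).
    rewrite -(mul0r (norm (fun x => (phi x)^-1 * psi x))).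
    by apply: cvgM; [exact: log_grad_cvg|exact: cvg_cst].
  apply: (@squeeze_cvgr _ _ _ _ (cst 0) _ _ _ _ _ h); last exact: cvg_cst.
  apply: nearW => n; rewrite normr_ge0 /= wE normrN; apply: cauchy_schwarz => //.
  exact: L2_log_grad.
exact: (cvg_unique _ lim1 lim0).
Qed.

Lemma eigenvector_multiple : lam = pi ^+ 2 ->
  exists c : R, ae_on Om v (fun x => c * phi x).
Proof.
move=> lamE.
have ih p q : cbox p q `<=` Om ->
    (@volume R).-integrable (obox p q) (EFin \o (fun x => (phi x)^-1 * v x)).
  move=> pqO; have mS : measurable (obox p q : set M) by exact: measurable_obox.
  have SO := obox_sub pqO.
  have Lv' := L2_obox oO Lv pqO.
  have ci : {within cbox p q, continuous (fun x => (phi x)^-1)}.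
    apply: continuous_in_subspaceT => x; rewrite inE => /pqO.
    exact: (Ck_continuous (Ck_inv_ground 0)).
  have [N N0 bN] := compact_image_bounded (@compact_cbox _ p q) ci.
  have Li : L2 (obox p q) (fun x => (phi x)^-1).
    apply: (L2_bounded mS (N := N)); first exact: volume_obox_lty.
      by apply: Ck_measurable; [exact: open_obox|exact: Ck_sub SO (Ck_inv_ground 0)].
    by move=> x /obox_cbox; exact: bN.
  have h := L2_mul_integrable mS Li Lv'.
  exact: h.
have [c hc] := gradient_free_cst_open oO ih
  (fun c x y => @annulus_locally_constant R A c x y A0)
  (fun i psi => quotient_gradient_free i lamE).
exists c; apply: filterS hc => x hx Ox; have := hx Ox => <-.
by rewrite mulrAC mulVf ?mul1r // gt_eqF // ground_gt0.
Qed.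

End eigenvector.

Lemma eigenspaceP lam (v : V -> R) : eigenspace_op A lam v ->
  L2 Om v /\ exists w : (V -> R)^nat, [/\ forall n, test_function Om (w n),
    L2_cvg Om w v,
    forall e : R, 0 < e -> exists N : nat, forall m n,
      (N <= m)%N -> (N <= n)%N -> energy A (w m \- w n) (w m \- w n) < e &
    forall psi, test_function Om psi ->
      inner v (fun x => - laplacian psi x) = lam * inner v psi].
Proof.
move=> [_ _ [Lv _ [w [tw wv wC]] veq]]; split => //; exists w; split => //.
  move=> e e0; have [N hN] := wC e e0; exists N => m n Nm Nn.
  by rewrite -energyE //; [exact: hN|exact: test_sub|exact: test_sub].
by move=> psi tpsi; rewrite veq // L2_innerZl //; exact: L2t.
Qed.

Lemma pi2_eigenvalue : eigenvalues A (pi ^+ 2).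
Proof. by exists phi; [exact: ground_eigenvector|exact: ground_neq0]. Qed.

Lemma pi2_lbound lam : eigenvalues A lam -> pi ^+ 2 <= lam.
Proof.
move=> [v /eigenspaceP[Lv [w [tw wv wC veq]]] v0].
exact: (pi2_le_eigenvalue Lv tw wv wC veq).
Qed.

Lemma lambda1E : lambda1 A = pi ^+ 2.
Proof.
apply/eqP; rewrite eq_le; apply/andP; split.
  apply: ge_inf; last exact: pi2_eigenvalue.
  by exists (pi ^+ 2) => lam; exact: pi2_lbound.
apply: lb_le_inf; first by exists (pi ^+ 2); exact: pi2_eigenvalue.
by move=> lam; exact: pi2_lbound.
Qed.

Lemma pi2_simple : simple_eigenvalue A (pi ^+ 2).
Proof.
exists phi; split; [exact: ground_eigenvector|exact: ground_neq0|].
move=> v /eigenspaceP[Lv [w [tw wv wC veq]]].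
exact: (eigenvector_multiple Lv tw wv wC veq).
Qed.

End spectrum.

Unset Implicit Arguments.

Theorem corollary6 (R : realType) :
  (forall A : R, 0 < A ->
     [/\ eigenvalues A (lambda1 A),
         forall lam : R, eigenvalues A lam -> lambda1 A <= lam &
         simple_eigenvalue A (lambda1 A)]) /\
  lambda1 A @[A --> +oo] --> (pi : R) ^+ 2.
Proof.
split=> [A A0|].
  rewrite lambda1E //; split; [exact: pi2_eigenvalue| |exact: pi2_simple].
  by move=> lam; exact: pi2_lbound.
apply: (@cvg_trans _ (cst ((pi : R) ^+ 2) A @[A --> +oo])); last exact: cvg_cst.
apply: near_eq_cvg; apply: filterS (nbhs_pinfty_gt (num_real (0 : R))) => A A0.
by rewrite lambda1E.
Qed.
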